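(* Let $K$ be an algebraically closed field (of arbitrary characteristic) and let $(Q,Sp,I)$ be a skewed-gentle triple, with corresponding skewed-gentle pair $(Q^{sg},I^{sg})$ and associated gentle pair $(Q^g,I^g)$. Then the following statements are equivalent: (i) $\mathrm{gldim}\, KQ^{sg}/\langle I^{sg}\rangle<\infty$; (ii) $\mathrm{gldim}\, KQ/\langle I\rangle<\infty$; (iii) $\mathrm{gldim}\, KQ^g/\langle I^g\rangle<\infty$.
   Context: $\mathrm{gldim}$ denotes global dimension. Quivers are finite. For an arrow $\alpha$, $s(\alpha)$ and $t(\alpha)$ denote its starting and ending vertex. Paths are written $\alpha_1\alpha_2\cdots\alpha_r$ with $t(\alpha_i)=s(\alpha_{i-1})$ for $2\le i\le r$ (composition from right to left). $\langle I\rangle$ denotes the ideal of the path algebra $KQ$ generated by $I$. Gentle pair: $(Q,I)$, with $I$ a set of paths of length $2$ in $Q$ and $\langle I\rangle$ an admissible ideal (so $KQ/\langle I\rangle$ is finite dimensional), is gentle if (1) each vertex is the starting point of at most two arrows and the end point of at most two arrows; (2) for each arrow $\alpha$ there is at most one arrow $\beta$ with $t(\beta)=s(\alpha)$ and $\alpha\beta\notin I$, and at most one arrow $\gamma$ with $s(\gamma)=t(\alpha)$ and $\gamma\alpha\notin I$; (3) for each arrow $\alpha$ there is at most one arrow $\beta$ with $t(\beta)=s(\alpha)$ and $\alpha\beta\in I$, and at most one arrow $\gamma$ with $s(\gamma)=t(\alpha)$ and $\gamma\alpha\in I$. Skewed-gentle triple: $(Q,Sp,I)$ where $(Q,I)$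 is a gentle pair and $Sp\subseteq Q_0$ is a set of vertices (the special vertices; the other vertices are called ordinary) such that the pair $(Q^{sp},I^{sp})$ is also gentle (including admissibility of $\langle I^{sp}\rangle$), where $Q^{sp}$ is obtained from $Q$ by adding one loop $\alpha_i$ at each $i\in Sp$ and $I^{sp}=I\cup\{\alpha_i^2\mid i\in Sp\}$. Skewed-gentle pair $(Q^{sg},I^{sg})$ of $(Q,Sp,I)$: for $i\in Q_0$ set $Q_0(i)=\{i\}$ if $i$ is ordinary and $Q_0(i)=\{i^-,i^+\}$ if $i$ is special. The vertex set is $Q_0^{sg}=\bigcup_{i\in Q_0}Q_0(i)$; the arrows from $a$ to $b$ are the triples $(a,\alpha,b)$ with $\alpha\in Q_1$, $a\in Q_0(s(\alpha))$, $b\in Q_0(t(\alpha))$; and $$I^{sg}=\Big\{\sum_{b\in Q_0(s(\alpha))}\lambda_b\,(b,\alpha,c)(a,\beta,b)\ \Big|\ \alpha\beta\in I,\ a\in Q_0(s(\beta)),\ c\in Q_0(t(\alpha))\Big\},$$ where $\lambda_b=-1$ if $b=i^-$ for some $i\in Q_0$ and $\lambda_b=1$ otherwise. Associated gentle pair $(Q^g,I^g)$ of $(Q,Sp,I)$: for $i\in Q_0$ set $Q_0[i]=\{i\}$ if $i$ is special and $Q_0[i]=\{i^-,i^+\}$ if $i$ is ordinary. Then $Q_0^g=\bigcup_{i\in Q_0}Q_0[i]$, $Q_1^g=\{\alpha^+,\alpha^-\mid\alpha\in Q_1\}$, with $s(\alpha^{\pm})=s(\alpha)^{\pm}$ if $s(\alpha)\notin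 Sp$ and $s(\alpha^\pm)=s(\alpha)$ if $s(\alpha)\in Sp$; $t(\alpha^{\pm})=t(\alpha)^{\pm}$ if $t(\alpha)\notin Sp$ and $t(\alpha^\pm)=t(\alpha)$ if $t(\alpha)\in Sp$; and $$I^g=\{\beta^+\alpha^+,\beta^-\alpha^-\mid\beta\alpha\in I,\ t(\alpha)\notin Sp\}\cup\{\beta^+\alpha^-,\beta^-\alpha^+\mid\beta\alpha\in I,\ t(\alpha)\in Sp\}.$$ *)

(* Defs.v *)
From HB Require Import structures.
From mathcomp Require Import all_boot all_algebra.
From mathcomp Require Import finmap monalg.
From mathcomp.classical Require Import boolp.

Set Implicit Arguments.
Unset Strict Implicit.
Unset Printing Implicit Defensive.

Import GRing.Theory.
Local Open Scope ring_scope.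

Section Ideals.
Variable R : pzRingType.
Implicit Types S J : R -> Prop.

Definition two_sided_ideal J : Prop :=
  [/\ J 0, forall x y, J x -> J y -> J (x + y)
    & forall a b x, J x -> J (a * x * b)].

Definition ideal_gen S : R -> Prop :=
  fun x => forall J, two_sided_ideal J -> (forall y, S y -> J y) -> J x.

Definition ideal_pow J (m : nat) : R -> Prop :=
  ideal_gen (fun x => exists f : 'I_m -> R,
    (forall i, J (f i)) /\ x = \prod_(i < m) f i).

Lemma ideal_genP S : two_sided_ideal (ideal_gen S).
Proof.
split=> [J [] //|x y hx hy J hJ hS|a b x hx J hJ hS].
  by case: (hJ) => _ + _; apply; [apply: hx|apply: hy].
by case: (hJ) => _ _; apply; apply: hx.
Qed.

Lemma ideal_gen_sub S x : S x -> ideal_gen S x.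
Proof. by move=> Sx J _; apply. Qed.

Definition ideal_pred S : {pred R} := fun x => `[< ideal_gen S x >].

Lemma ideal_predP S x : reflect (ideal_gen S x) (x \in ideal_pred S).
Proof. exact: asboolP. Qed.

Lemma ideal_pred_zmod_closed S : zmod_closed (ideal_pred S).
Proof.
have [h0 hD hM] := ideal_genP S; split; first exact/ideal_predP.
move=> x y /ideal_predP hx /ideal_predP hy; apply/ideal_predP.
apply: hD => //; have := hM (-1) 1 y hy.
by rewrite mulN1r mulr1.
Qed.

HB.instance Definition _ S :=
  GRing.isZmodClosed.Build R (ideal_pred S) (ideal_pred_zmod_closed S).

Lemma ideal_predMr S a x : x \in ideal_pred S -> a * x \in ideal_pred S.
Proof.
have [_ _ hM] := ideal_genP S.
by move=> /ideal_predP hx; apply/ideal_predP; rewrite -[_ * _]mulr1; apply: hM.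
Qed.

Lemma ideal_predMl S a x : x \in ideal_pred S -> x * a \in ideal_pred S.
Proof.
have [_ _ hM] := ideal_genP S.
by move=> /ideal_predP hx; apply/ideal_predP; rewrite -[x]mul1r; apply: hM.
Qed.

End Ideals.

Section QuotientRing.
Variables (R : pzRingType) (S : R -> Prop).
Local Open Scope quotient_scope.

Definition quot_ring := Quotient.quot (ideal_pred S).

HB.instance Definition _ := GRing.Zmodule.on quot_ring.
HB.instance Definition _ : EqQuotient R (Quotient.equiv (ideal_pred S)) quot_ring
  := EqQuotient.on quot_ring.

Definition quot_one : quot_ring := \pi_quot_ring 1.
Definition quot_mul (x y : quot_ring) : quot_ring := \pi_quot_ring (repr x * repr y).

Lemma quot_piE (x y : R) : (\pi_quot_ring x == \pi_quot_ring y) = (x - y \in ideal_pred S).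
Proof. by rewrite [RHS]Quotient.idealrBE. Qed.

Lemma quot_reprB (x : R) : repr (\pi_quot_ring x) - x \in ideal_pred S.
Proof. by rewrite -quot_piE reprK. Qed.

Lemma quot_mulE x y : quot_mul (\pi x) (\pi y) = \pi_quot_ring (x * y).
Proof.
apply/eqP; rewrite quot_piE.
set x' := repr _; set y' := repr _.
rewrite -[X in X - _](subrK (x * y')) -mulrBl -addrA -mulrBr rpredD //.
  exact/ideal_predMl/quot_reprB.
exact/ideal_predMr/quot_reprB.
Qed.

Lemma quot_piD (x y : R) : \pi_quot_ring (x + y) = \pi x + \pi y.
Proof. exact: Quotient.pi_add. Qed.

Lemma quot_mulA : associative quot_mul.
Proof.
by move=> x y z; rewrite -[x]reprK -[y]reprK -[z]reprK !quot_mulE mulrA.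
Qed.

Lemma quot_mul1 : left_id quot_one quot_mul.
Proof. by move=> x; rewrite -[x]reprK quot_mulE mul1r. Qed.

Lemma quot_mulr1 : right_id quot_one quot_mul.
Proof. by move=> x; rewrite -[x]reprK quot_mulE mulr1. Qed.

Lemma quot_mulDl : left_distributive quot_mul +%R.
Proof.
move=> x y z; rewrite -[x]reprK -[y]reprK -[z]reprK.
by rewrite -quot_piD !quot_mulE -quot_piD mulrDl.
Qed.

Lemma quot_mulDr : right_distributive quot_mul +%R.
Proof.
move=> x y z; rewrite -[x]reprK -[y]reprK -[z]reprK.
by rewrite -quot_piD !quot_mulE -quot_piD mulrDr.
Qed.

HB.instance Definition _ := GRing.Zmodule_isPzRing.Build quot_ring
  quot_mulA quot_mul1 quot_mulr1 quot_mulDl quot_mulDr.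

End QuotientRing.

Section GlobalDimension.
Variable A : pzRingType.

Definition surjective (M N : Type) (f : M -> N) : Prop :=
  forall y, exists x, f x = y.

Definition projective (P : lmodType A) : Prop :=
  forall (M N : lmodType A) (g : {linear M -> N}) (f : {linear P -> N}),
    surjective g -> exists h : {linear P -> M}, forall x, g (h x) = f x.

(* M has a projective resolution  ... -> P 1 -> P 0 -> M -> 0  with P i = 0
   for all i > n. *)
Definition pdim_le (M : lmodType A) (n : nat) : Prop :=
  exists (P : nat -> lmodType A) (d : forall i, {linear P i.+1 -> P i})
         (e : {linear P 0%N -> M}),
  [/\ forall i, projective (P i),
      surjective e,
      forall x, e x = 0 <-> exists y, d 0%N y = x,
      forall i x, d i x = 0 <-> exists y, d i.+1 y = x
    & forall i, (n < i)%N -> forall x : P i, x = 0].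

(* Left global dimension; it agrees with the right one for the
   finite-dimensional algebras considered below. *)
Definition gldim_finite : Prop :=
  exists n : nat, forall M : lmodType A, pdim_le M n.

End GlobalDimension.

Record quiver := Quiver {
  vert : finType;
  arr : finType;
  src : arr -> vert;
  tgt : arr -> vert
}.

Section Paths.
Variable Q : quiver.

Fixpoint is_path (v : vert Q) (w : seq (arr Q)) : bool :=
  if w is a :: w' then (tgt a == v) && is_path (src a) w' else true.

(* A path is its target vertex together with its word a1 a2 ... ar, where
   tgt a_i = src a_(i-1); the trivial path at v is (v, [::]). *)
Definition qpath := {p : vert Q * seq (arr Q) | is_path p.1 p.2}.
HB.instance Definition _ := SubChoice.on qpath.

Definition ptgt (p : qpath) : vert Q := (val p).1.
Definition parrs (p : qpath) : seq (arr Q) := (val p).2.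
Definition psrc (p : qpath) : vert Q := last (ptgt p) (map (@src Q) (parrs p)).

Definition triv_path (v : vert Q) : qpath := exist _ (v, [::]) isT.

Lemma arr_path_subproof (a : arr Q) : is_path (tgt a) [:: a].
Proof. by rewrite /= eqxx. Qed.
Definition arr_path (a : arr Q) : qpath :=
  exist _ (tgt a, [:: a]) (arr_path_subproof a).

(* p q is q followed by p, defined when psrc p = ptgt q. *)
Definition pcomp (p q : qpath) : option qpath :=
  if psrc p == ptgt q then insub (ptgt p, parrs p ++ parrs q) else None.

Lemma is_path_cat v w1 w2 :
  is_path v (w1 ++ w2) =
  is_path v w1 && is_path (last v (map (@src Q) w1)) w2.
Proof. by elim: w1 v => //= a w1 IH v; rewrite IH andbA. Qed.

Lemma pcompP p q : psrc p = ptgt q ->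
  exists2 r, pcomp p q = Some r & val r = (ptgt p, parrs p ++ parrs q).
Proof.
move=> e; rewrite /pcomp e eqxx; case: insubP => [r _ vr|]; first by exists r.
case: p e => -[v w] /= hw; rewrite /psrc /ptgt /parrs /= => e.
by case: q e => -[v' w'] /= hw' e; rewrite is_path_cat hw e hw'.
Qed.

Lemma pcompN p q : psrc p != ptgt q -> pcomp p q = None.
Proof. by rewrite /pcomp => /negPf ->. Qed.

Lemma pcomp_src p q r : pcomp p q = Some r -> psrc r = psrc q.
Proof.
rewrite /pcomp; case: eqP => // e; case: insubP => // u _ vu [<-].
by rewrite /psrc /ptgt /parrs vu map_cat last_cat -/(psrc p) e.
Qed.

Lemma pcomp_tgt p q r : pcomp p q = Some r -> ptgt r = ptgt p.
Proof.
rewrite /pcomp; case: eqP => // e; case: insubP => // u _ vu [<-].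
by rewrite /ptgt vu.
Qed.

Lemma pcompA p q r :
  obind (pcomp p) (pcomp q r) = obind (pcomp^~ r) (pcomp p q).
Proof.
have [e1|n1] := eqVneq (psrc q) (ptgt r); have [e2|n2] := eqVneq (psrc p) (ptgt q).
- have [s es vs] := pcompP e1; have [t et vt] := pcompP e2; rewrite es et /=.
  have [u -> vu] : exists2 u, pcomp p s = Some u &
      val u = (ptgt p, parrs p ++ parrs s).
    by apply: pcompP; rewrite (pcomp_tgt es).
  have [v -> vv] : exists2 v, pcomp t r = Some v &
      val v = (ptgt t, parrs t ++ parrs r).
    by apply: pcompP; rewrite (pcomp_src et).
  congr Some; apply: val_inj; rewrite vu vv /ptgt /parrs vs vt /=.
  by rewrite -/(parrs q) -/(parrs r) catA.
- have [s es _] := pcompP e1; rewrite es (pcompN n2) /= pcompN //.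
  by rewrite (pcomp_tgt es).
- have [t et _] := pcompP e2; rewrite et (pcompN n1) /= pcompN //.
  by rewrite (pcomp_src et).
- by rewrite !pcompN.
Qed.

Lemma pcomp_trivl v p :
  pcomp (triv_path v) p = if v == ptgt p then Some p else None.
Proof.
rewrite /pcomp /psrc /=; case: eqP => [->|//].
have -> : (ptgt (triv_path (ptgt p)), parrs (triv_path (ptgt p)) ++ parrs p) = val p.
  by rewrite /ptgt /parrs; case: (val p).
by rewrite valK.
Qed.

Lemma pcomp_trivr v p :
  pcomp p (triv_path v) = if v == psrc p then Some p else None.
Proof.
rewrite /pcomp [ptgt (triv_path v)]/ptgt /= eq_sym; case: eqP => [_|//].
have -> : (ptgt p, parrs p ++ parrs (triv_path v)) = val p.
  by rewrite /ptgt /parrs cats0; case: (val p).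
by rewrite valK.
Qed.

End Paths.

Arguments pcomp {Q}.
Arguments triv_path {Q}.

Section LinearExtension.
Variables (K : fieldType) (T : choiceType) (V : lmodType K).

Definition lin_ext (h : T -> V) (f : {malg K[T]}) : V :=
  \sum_(p <- msupp f) f@_p *: h p.

Lemma lin_extw h (f : {malg K[T]}) (D : {fset T}) : (msupp f `<=` D)%fset ->
  lin_ext h f = \sum_(p <- D) f@_p *: h p.
Proof.
move=> sub; rewrite /lin_ext; apply: big_fset_incl => // x _.
by move=> /mcoeff_outdom ->; rewrite scale0r.
Qed.

Lemma lin_ext_linear h : linear (lin_ext h).
Proof.
move=> c f g; pose D := (msupp f `|` msupp g)%fset.
rewrite !(@lin_extw h _ D) ?fsubsetUl ?fsubsetUr //.
  rewrite scaler_sumr -big_split /=; apply: eq_bigr => p _.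
  by rewrite mcoeffD mcoeffZ scalerDl scalerA.
by apply/(fsubset_trans (msuppD_le _ _))/fsetSU/msuppZ_le.
Qed.

HB.instance Definition _ h :=
  GRing.isLinear.Build K {malg K[T]} V *:%R (lin_ext h) (lin_ext_linear h).

Lemma lin_extU h p : lin_ext h << p >> = h p.
Proof.
by rewrite /lin_ext msuppU oner_eq0 big_seq_fset1 mcoeffUU scale1r.
Qed.

Lemma eq_lin_ext h h' : h =1 h' -> lin_ext h =1 lin_ext h'.
Proof. by move=> e f; apply: eq_bigr => p _; rewrite e. Qed.

End LinearExtension.

Lemma lin_ext_comp (K : fieldType) (T : choiceType) (V W : lmodType K)
    (L : {linear V -> W}) (h : T -> V) f :
  L (lin_ext h f) = lin_ext (L \o h) f.
Proof. by rewrite linear_sum; apply: eq_bigr => p _; rewrite linearZ. Qed.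

Lemma lin_ext_id (K : fieldType) (T : choiceType) (f : {malg K[T]}) :
  lin_ext (fun p => << p >> : {malg K[T]}) f = f.
Proof.
rewrite [RHS]monalgE; apply: eq_bigr => p _.
by apply/malgP => k; rewrite mcoeffZ !mcoeffU mulrnAr mulr1.
Qed.

Section PathAlgebra.
Variables (K : fieldType) (Q : quiver).

Definition path_alg := {malg K[qpath Q]}.
HB.instance Definition _ := GRing.Lmodule.on path_alg.

Definition pa_path (p : qpath Q) : path_alg := << p >>.
Definition pa_arr (a : arr Q) : path_alg := pa_path (arr_path a).

Definition pa_one : path_alg := \sum_(v : vert Q) pa_path (triv_path v).
Definition pa_mulp (p q : qpath Q) : path_alg := oapp pa_path 0 (pcomp p q).
Definition pa_mul (f g : path_alg) : path_alg :=
  lin_ext (fun p => lin_ext (pa_mulp p) g) f.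

Lemma pa_mulDl : left_distributive pa_mul +%R.
Proof. by move=> f g h; rewrite /pa_mul linearD. Qed.

Lemma pa_mulDr : right_distributive pa_mul +%R.
Proof.
move=> f g h; rewrite /pa_mul [LHS]/lin_ext.
under eq_bigr do rewrite linearD scalerDr.
by rewrite big_split.
Qed.

Lemma pa_mulpA p q (h : path_alg) :
  lin_ext (fun r => lin_ext (pa_mulp p) (pa_mulp q r)) h =
  lin_ext (fun s => lin_ext (pa_mulp s) h) (pa_mulp p q).
Proof.
transitivity (lin_ext (fun r =>
    oapp pa_path 0 (obind (pcomp^~ r) (pcomp p q)) : path_alg) h).
  apply: eq_lin_ext => r; rewrite -pcompA {2}/pa_mulp.
  by case: (pcomp q r) => [s|] /=; [exact: lin_extU|exact: linear0].
rewrite {2}/pa_mulp; case: (pcomp p q) => [s|] /=.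
  by symmetry; exact: lin_extU.
transitivity (0 : path_alg); last by symmetry; exact: linear0.
by apply: big1 => r _; exact: scaler0.
Qed.

Lemma pa_mulA : associative pa_mul.
Proof.
move=> f g h; rewrite /pa_mul.
transitivity (lin_ext (fun p => lin_ext (fun s => lin_ext (pa_mulp s) h)
  (lin_ext (pa_mulp p) g) : path_alg) f); last by symmetry; exact: lin_ext_comp.
apply: eq_lin_ext => p.
transitivity (lin_ext (fun q => lin_ext (pa_mulp p) (lin_ext (pa_mulp q) h)
  : path_alg) g); first exact: lin_ext_comp.
transitivity (lin_ext (fun q => lin_ext (fun s => lin_ext (pa_mulp s) h)
  (pa_mulp p q) : path_alg) g); last by symmetry; exact: lin_ext_comp.
apply: eq_lin_ext => q; rewrite -pa_mulpA; exact: lin_ext_comp.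
Qed.

Lemma pa_mul1 : left_id pa_one pa_mul.
Proof.
move=> f; rewrite /pa_mul /pa_one linear_sum /=.
under eq_bigr do rewrite lin_extU /lin_ext.
rewrite exchange_big -[RHS]lin_ext_id; apply: eq_bigr => p _.
rewrite -scaler_sumr; congr (_ *: _).
rewrite (bigD1 (ptgt p)) //= /pa_mulp pcomp_trivl eqxx /= big1 ?addr0 //.
by move=> v /negPf vp; rewrite pcomp_trivl vp.
Qed.

Lemma pa_mulr1 : right_id pa_one pa_mul.
Proof.
move=> f; rewrite /pa_mul -[RHS]lin_ext_id; apply: eq_lin_ext => p.
rewrite /pa_one linear_sum /=.
under eq_bigr do rewrite lin_extU.
rewrite (bigD1 (psrc p)) //= /pa_mulp pcomp_trivr eqxx /= big1 ?addr0 //.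
by move=> v /negPf vp; rewrite pcomp_trivr vp.
Qed.

HB.instance Definition _ := GRing.Zmodule_isPzRing.Build path_alg
  pa_mulA pa_mul1 pa_mulr1 pa_mulDl pa_mulDr.

Definition arrow_ideal : path_alg -> Prop :=
  ideal_gen (fun x => exists a, x = pa_arr a).

Definition admissible (J : path_alg -> Prop) : Prop :=
  (forall x, J x -> ideal_pow arrow_ideal 2 x) /\
  exists2 m, (2 <= m)%N & forall x, ideal_pow arrow_ideal m x -> J x.

(* A pair (a, b) in I stands for the path a b of length 2 (b, then a). *)
Definition pa_rels (I : {set arr Q * arr Q}) : path_alg -> Prop :=
  fun x => exists2 p, p \in I & x = pa_arr p.1 * pa_arr p.2.

Definition gentle (I : {set arr Q * arr Q}) : Prop :=
  [/\ forall a b, (a, b) \in I -> tgt b = src a,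
      admissible (ideal_gen (pa_rels I)),
      forall v : vert Q, (#|[set a : arr Q | src a == v]| <= 2)%N /\
                         (#|[set a : arr Q | tgt a == v]| <= 2)%N,
      forall a : arr Q,
        (#|[set b : arr Q | (tgt b == src a) && ((a, b) \notin I)]| <= 1)%N /\
        (#|[set c : arr Q | (src c == tgt a) && ((c, a) \notin I)]| <= 1)%N
    & forall a : arr Q,
        (#|[set b : arr Q | (tgt b == src a) && ((a, b) \in I)]| <= 1)%N /\
        (#|[set c : arr Q | (src c == tgt a) && ((c, a) \in I)]| <= 1)%N].

End PathAlgebra.

Section SkewedGentle.
Variables (K : fieldType) (Q : quiver).
Variables (Sp : {set vert Q}) (I : {set arr Q * arr Q}).

Definition quiver_sp : quiver :=
  @Quiver (vert Q) (arr Q + {v : vert Q | v \in Sp})%type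
    (fun x => match x with inl a => src a | inr v => val v end)
    (fun x => match x with inl a => tgt a | inr v => val v end).

Definition rels_sp : {set arr quiver_sp * arr quiver_sp} :=
  [set p | match p with
           | (inl a, inl b) => (a, b) \in I
           | (inr v, inr w) => v == w
           | _ => false
           end].

Definition skewed_gentle : Prop := gentle K I /\ gentle K rels_sp.

End SkewedGentle.

Section SplitVertices.
Variables (V : finType) (S : {set V}).

(* The vertices of S are doubled, the others are kept: (v, Some true) is v^+,
   (v, Some false) is v^-, and (v, None) is v itself. *)
Definition split_vert :=
  {p : V * option bool | isSome p.2 == (p.1 \in S)}.
HB.instance Definition _ := SubFinite.on split_vert.

Definition base (x : split_vert) : V := (val x).1.
Definition is_minus (x : split_vert) : bool := (val x).2 == Some false.

Lemma split_at_subproof (v : V) (e : bool) :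
  isSome (if v \in S then Some e else None) == (v \in S).
Proof. by case: (v \in S). Qed.
Definition split_at (v : V) (e : bool) : split_vert :=
  exist _ (v, if v \in S then Some e else None) (split_at_subproof v e).

End SplitVertices.

Section SkewedGentlePair.
Variables (K : fieldType) (Q : quiver).
Variables (Sp : {set vert Q}) (I : {set arr Q * arr Q}).

Definition arr_sg :=
  {t : split_vert Sp * arr Q * split_vert Sp |
    (base t.1.1 == src t.1.2) && (base t.2 == tgt t.1.2)}.
HB.instance Definition _ := SubFinite.on arr_sg.

Definition quiver_sg : quiver :=
  @Quiver (split_vert Sp) arr_sg (fun t => (val t).1.1) (fun t => (val t).2).

(* The arrow (a, al, b); the value 0 is only taken on triples which are not
   arrows, and these do not occur in rels_sg. *)
Definition pa_arr_sg (a : split_vert Sp) (al : arr Q) (b : split_vert Sp) :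
    path_alg K quiver_sg :=
  oapp (@pa_arr K quiver_sg) 0 (insub (a, al, b) : option arr_sg).

Definition sg_sign (b : split_vert Sp) : K := if is_minus b then -1 else 1.

Definition rels_sg : path_alg K quiver_sg -> Prop :=
  fun x => exists (al be : arr Q) (a c : split_vert Sp),
    [/\ (al, be) \in I, base a = src be, base c = tgt al
      & x = \sum_(b : split_vert Sp | base b == src al)
              sg_sign b *: (pa_arr_sg b al c * pa_arr_sg a be b)].

End SkewedGentlePair.

Section AssociatedGentlePair.
Variables (Q : quiver) (Sp : {set vert Q}) (I : {set arr Q * arr Q}).

(* Here it is the ordinary vertices that are doubled; (al, e) is al^+ or al^-. *)
Definition quiver_g : quiver :=
  @Quiver (split_vert (~: Sp)) (arr Q * bool)%type
    (fun x => split_at (~: Sp) (src x.1) x.2)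
    (fun x => split_at (~: Sp) (tgt x.1) x.2).

Definition rels_g : {set arr quiver_g * arr quiver_g} :=
  [set p : (arr Q * bool) * (arr Q * bool) |
    ((p.1.1, p.2.1) \in I) &&
    (if tgt p.2.1 \in Sp then p.1.2 != p.2.2 else p.1.2 == p.2.2)].

End AssociatedGentlePair.

(* Main.v *)
(* All three algebras are instances of one construction: a path algebra modulo
   relations g_x g_y, where g_x is a signed sum of the arrows with label x and
   (x, y) ranges over I.  Stripping the rightmost arrow off paths gives, for each
   vertex v and label x with source v, a map D from the path algebra to itself
   which is a derivation up to augmentation, sends g_x to the idempotent of the
   target of x and sends the ideal of relations <R> into <R> + K Q g_y, where y
   is the unique label with (y, x) in I.  Hence the kernel of right
   multiplication by g_x on A e_x is A g_y, and the radical of A e_v is the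
   direct sum of the modules A g_x e_v.

   If no sequence of successive predecessors x, y, ... is infinite, this bounds
   the projective dimension of the A g_x, then of the simple modules, then of
   all modules through the radical filtration.  If such a sequence is infinite
   and gldim A is finite, dimension shifting makes some A g_x projective; then
   A e_x -> A g_x splits, its kernel A g_y is generated by an idempotent of the
   nilpotent radical, so g_y = 0, which D excludes.

   So the global dimension is finite exactly when I has no infinite chain.  The
   chains are the same for (Q, I) and for the skewed-gentle algebra, and those
   of the associated gentle pair lie over them. *)
From HB Require Import structures.
From mathcomp Require Import all_boot all_algebra.
From mathcomp Require Import finmap monalg.
From mathcomp.classical Require Import boolp classical_sets.
Require Import Defs.

Set Implicit Arguments.
Unset Strict Implicit.
Unset Printing Implicit Defensive.

Import GRing.Theory.
Local Open Scope ring_scope.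

(** * Modules, exact sequences and projective dimension *)

Section Modules.
Variable A : pzRingType.
Implicit Types M N P : lmodType A.

Definition mklin M N (f : M -> N) (f_lin : linear f) : {linear M -> N} :=
  HB.pack f (GRing.isLinear.Build A M N *:%R f f_lin).

Definition is_submod M (S : M -> Prop) : Prop :=
  S 0 /\ forall a x y, S x -> S y -> S (a *: x + y).

Section Submodule.
Variables (M : lmodType A) (S : M -> Prop) (hS : is_submod S).

Definition submod_pred (_ : is_submod S) : {pred M} := fun x => `[< S x >].

Lemma submod_pred_closed : submod_closed (submod_pred hS).
Proof.
case: (hS) => h0 hD; split; first exact/asboolP.
by move=> a x y /asboolP Sx /asboolP Sy; apply/asboolP/hD.
Qed.

HB.instance Definition _ := GRing.isSubmodClosed.Build A M (submod_pred hS)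
  submod_pred_closed.

Definition submod := {x : M | submod_pred hS x}.
HB.instance Definition _ := SubChoice.on submod.
HB.instance Definition _ := [SubChoice_isSubLmodule of submod by <:].

Lemma submodP (x : submod) : S (val x).
Proof. by case: x => x /= /asboolP. Qed.

Definition Submod x (Sx : S x) : submod := Sub x (asboolT Sx).

Lemma submod_val_linear : linear (val : submod -> M).
Proof. by []. Qed.
Definition submod_incl : {linear submod -> M} := mklin submod_val_linear.

Lemma submod_inclE x : submod_incl x = val x. Proof. by []. Qed.

Lemma submod_incl_inj : injective submod_incl.
Proof. exact: val_inj. Qed.

End Submodule.

Lemma ker_submod M N (f : {linear M -> N}) : is_submod (fun x => f x = 0).
Proof. by split=> [|a x y fx fy]; rewrite ?linear0 // linearP fx fy scaler0 addr0. Qed.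

Lemma range_submod M N (f : {linear M -> N}) : is_submod (fun y => exists x, y = f x).
Proof.
split=> [|a _ _ [x ->] [y ->]]; first by exists 0; rewrite linear0.
by exists (a *: x + y); rewrite linearP.
Qed.

(** Injectivity of [i] makes the chosen preimages unique, which forces the choice function to be
    linear. Maps into submodules are built this way throughout. *)
Lemma lin_factor M N P (f : {linear M -> P}) (i : {linear N -> P}) :
  injective i -> (forall x, exists y, i y = f x) ->
  exists f' : {linear M -> N}, forall x, i (f' x) = f x.
Proof.
move=> inj_i /choice [h hE].
have h_lin : linear h by move=> a x y; apply: inj_i; rewrite linearP !hE linearP.
by exists (mklin h_lin).
Qed.

Lemma id_linear M : linear (id : M -> M). Proof. by []. Qed.

Lemma comp_linear M N P (f : {linear N -> P}) (g : {linear M -> N}) : linear (fun x => f (g x)).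
Proof. by move=> a x y; rewrite !linearP. Qed.

Definition exact_at M N P (i : {linear N -> P}) (p : {linear P -> M}) : Prop :=
  forall x, p x = 0 <-> exists y, i y = x.

Definition short_exact M N P (i : {linear N -> P}) (p : {linear P -> M}) : Prop :=
  [/\ injective i, surjective p & exact_at i p].

Lemma short_exact_ker M P (p : {linear P -> M}) :
  surjective p -> short_exact (submod_incl (ker_submod p)) p.
Proof.
move=> surj; split=> //; first exact: submod_incl_inj.
move=> x; split=> [px|[y <-]]; last exact: (submodP y).
by exists (Submod (ker_submod p) px).
Qed.

Lemma projective_split M P (p : {linear M -> P}) :
  projective P -> surjective p -> exists s : {linear P -> M}, cancel s p.
Proof.
move=> projP surj; have [s sE] := projP _ _ p (mklin (@id_linear P)) surj.
by exists s.
Qed.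

Lemma projective_retract M P (i : {linear M -> P}) (r : {linear P -> M}) :
  cancel i r -> projective P -> projective M.
Proof.
move=> ir projP X Y g f surj.
have [h hE] := projP _ _ g (mklin (comp_linear f r)) surj.
by exists (mklin (comp_linear h i)) => x /=; rewrite hE /= ir.
Qed.

Lemma pair_fun_linear M N P (f : {linear M -> P}) (g : {linear N -> P}) :
  linear (fun x : M * N => f x.1 + g x.2).
Proof.
by move=> a x y /=; rewrite !linearP scalerDr addrACA.
Qed.
Definition pair_fun M N P f g := mklin (@pair_fun_linear M N P f g).

Lemma fst_linear M N : linear (fst : M * N -> M). Proof. by []. Qed.
Lemma snd_linear M N : linear (snd : M * N -> N). Proof. by []. Qed.
Lemma inl_linear M N : linear (fun x : M => (x, 0) : M * N).
Proof. by move=> a x y; congr pair; rewrite /= ?scaler0 ?addr0. Qed.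
Lemma inr_linear M N : linear (fun x : N => (0, x) : M * N).
Proof. by move=> a x y; congr pair; rewrite /= ?scaler0 ?addr0. Qed.

Lemma projective_prod M N : projective M -> projective N -> projective (M * N)%type.
Proof.
move=> pM pN X Y g f surj.
have [h hE] := pM _ _ g (mklin (comp_linear f (mklin (@inl_linear M N)))) surj.
have [k kE] := pN _ _ g (mklin (comp_linear f (mklin (@inr_linear M N)))) surj.
exists (pair_fun h k) => -[x y] /=; rewrite linearD hE kE /= -linearD.
by congr (f (_, _)); rewrite /= ?addr0 ?add0r.
Qed.

(** A section of [p] splits the sequence, so [P] is a retract of [N * M]. *)
Lemma projective_ext M N P (i : {linear N -> P}) (p : {linear P -> M}) :
  short_exact i p -> projective N -> projective M -> projective P.
Proof.
move=> [inj_i surj_p ex] pN pM; have [s sK] := projective_split pM surj_p.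
have comp_lin : linear (fun x => x - s (p x)).
  by move=> a x y; rewrite !linearP addrACA -scalerDr.
have [|q qE] := @lin_factor _ _ _ (mklin comp_lin) i inj_i.
  by move=> x; apply/ex; rewrite /= linearB sK subrr.
have pair_lin : linear (fun x => (q x, p x) : N * M).
  by move=> a x y; congr pair; rewrite linearP.
apply: (@projective_retract _ _ (mklin pair_lin) (pair_fun i s)) (projective_prod pN pM).
by move=> x; rewrite /= qE /= subrK.
Qed.

(** A recursive form of [pdim_le] that peels off one syzygy at a time, suited to induction on [n];
    the two notions are compared in [gldim_finiteE]. *)
Fixpoint pd_le (n : nat) M : Prop :=
  if n is k.+1 then
    exists (P N : lmodType A) (i : {linear N -> P}) (p : {linear P -> M}),
      [/\ projective P, short_exact i p & pd_le k N]
  else projective M.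

Lemma projective0 M : (forall x : M, x = 0) -> projective M.
Proof.
move=> M0 X Y g f _; have lin0 : linear (fun _ : M => 0 : X).
  by move=> a x y; rewrite scaler0 addr0.
by exists (mklin lin0) => x; rewrite (M0 x) !linear0.
Qed.

Lemma pd_leS n M : pd_le n M -> pd_le n.+1 M.
Proof.
elim: n M => [|n IH] M.
  move=> pM; exists M, (submod (ker_submod (mklin (@id_linear M)))).
  exists (submod_incl _), (mklin (@id_linear M)); split=> //.
    by apply: short_exact_ker => y; exists y.
  by apply: projective0 => x; apply: val_inj; exact: (submodP x).
by case=> P [N [i [p [pP ex /IH hN]]]]; exists P, N, i, p.
Qed.

Lemma pd_le_leq n m M : (n <= m)%N -> pd_le n M -> pd_le m M.
Proof.
by move=> /subnK <-; elim: (m - n)%N => // k IH h; rewrite addSn; apply/pd_leS/IH.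
Qed.

Lemma pd_le_iso n M N (f : {linear M -> N}) :
  injective f -> surjective f -> pd_le n M -> pd_le n N.
Proof.
move=> inj surj; case: n => [|n] /=.
  have [g gK] := lin_factor (f := mklin (@id_linear N)) inj surj.
  by apply: projective_retract gK.
case=> P [L [i [p [pP [inj_i surj_p ex] hL]]]].
exists P, L, i, (mklin (comp_linear f p)); split=> //; split=> //=.
  by move=> y; have [x <-] := surj y; have [z <-] := surj_p x; exists z.
move=> x /=; rewrite -ex; split=> [|->]; last exact: linear0.
by rewrite -(linear0 f) => /inj.
Qed.

(** Horseshoe lemma: a surjection onto [N] and a lift through [p] of a surjection onto [M] combine
    into a surjection [c] onto [P]. The kernel of [c] is an extension of the two given syzygies, and
    induction applies to it. *)
Lemma pd_le_horseshoe n M N P (i : {linear N -> P}) (p : {linear P -> M}) :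
  short_exact i p -> pd_le n N -> pd_le n M -> pd_le n P.
Proof.
elim: n M N P i p => [|n IH] M N P i p ses; first exact: projective_ext ses.
case: ses => inj_i surj_p ex.
case=> P1 [N1 [i1 [p1 [pP1 [inj_i1 surj_p1 ex1] hN1]]]].
case=> P2 [N2 [i2 [p2 [pP2 [inj_i2 surj_p2 ex2] hN2]]]].
have [q qE] := pP2 _ _ p p2 surj_p.
pose c := pair_fun (mklin (comp_linear i p1)) q.
have surj_c : surjective c.
  move=> y; have [b bE] := surj_p2 (p y).
  have [m mE] : exists m, i m = y - q b.
    by apply/ex; rewrite linearB qE bE subrr.
  have [a aE] := surj_p1 m; exists (a, b).
  by rewrite /= aE mE subrK.
exists (P1 * P2)%type, (submod (ker_submod c)), (submod_incl _), c; split.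
- exact: projective_prod.
- exact: short_exact_ker.
have [|i' i'E] := @lin_factor _ _ _
    (mklin (comp_linear (mklin (@inl_linear P1 P2)) i1))
    (submod_incl (ker_submod c)) (@submod_incl_inj _ _ _).
  move=> x; have cx : c (i1 x, 0) = 0.
    rewrite /= linear0 addr0; suff -> : p1 (i1 x) = 0 by rewrite linear0.
    by apply/ex1; exists x.
  by exists (Submod (ker_submod c) cx).
have [|p' p'E] := @lin_factor _ _ _
    (mklin (comp_linear (mklin (@snd_linear P1 P2)) (submod_incl (ker_submod c))))
    i2 inj_i2.
  move=> x; apply/ex2; rewrite /= -qE.
  have := congr1 p (submodP x); rewrite /= linearD linear0.
  by rewrite (_ : p (i _) = 0) ?add0r //; apply/ex; eexists.
apply: (IH _ _ _ i' p' _ hN1 hN2); split.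
- move=> x y /(congr1 (submod_incl (ker_submod c))); rewrite !i'E /=.
  by move=> [] /inj_i1.
- move=> y; have [m mE] : exists m, i m = - q (i2 y).
    by apply/ex; rewrite linearN qE (_ : p2 _ = 0) ?oppr0 //; apply/ex2; exists y.
  have [a aE] := surj_p1 m.
  have cx : c (a, i2 y) = 0 by rewrite /= aE mE addNr.
  by exists (Submod (ker_submod c) cx); apply: inj_i2; rewrite p'E.
- move=> x; split=> [px|[y <-]].
    have x2 : (val x).2 = 0 by have := p'E x; rewrite px linear0.
    have /ex1 [y yE] : p1 (val x).1 = 0.
      by apply: inj_i; have := submodP x; rewrite /= x2 !linear0 addr0.
    exists y; apply: submod_incl_inj; rewrite i'E /= yE.
    by rewrite -x2 /=; case: (val x).
  by apply: inj_i2; rewrite p'E /= -!submod_inclE i'E linear0.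
Qed.

End Modules.

(** * Dimension shifting and comparison with projective resolutions *)

Section ProjectiveDimension.
Variable A : pzRingType.
Implicit Types M N P X : lmodType A.

Lemma exact_at0 M N P (i : {linear N -> P}) (p : {linear P -> M}) :
  exact_at i p -> forall x, p (i x) = 0.
Proof. by move=> ex x; apply/ex; exists x. Qed.

(** As [P] is projective, [N] is a direct summand of [X] with retraction [r]. A projective mapping
    onto [X] by [q] then maps onto [N] by [r] after [q], and the kernel is an extension of [P] by
    the syzygy of [X]. *)
Lemma pd_le_splitl n N X P (i : {linear N -> X}) (p : {linear X -> P}) :
  short_exact i p -> projective P -> pd_le n X -> pd_le n N.
Proof.
move=> [inj_i surj_p ex] pP; have [s sK] := projective_split pP surj_p.
have comp_lin : linear (fun x => x - s (p x)).
  by move=> a x y; rewrite !linearP addrACA -scalerDr.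
have [|r rE] := @lin_factor _ _ _ _ (mklin comp_lin) i inj_i.
  by move=> x; apply/ex; rewrite /= linearB sK subrr.
have rK : cancel i r.
  by move=> x; apply: inj_i; rewrite rE /= (exact_at0 ex) linear0 ?subr0 ?addr0.
case: n => [|n]; first exact: projective_retract rK.
case=> R [N1 [j [q [pR [inj_j surj_q exq] hN1]]]].
pose c := mklin (comp_linear r q).
have surj_c : surjective c.
  by move=> y; have [z zE] := surj_q (i y); exists z; rewrite /= zE rK.
exists R, (submod (ker_submod c)), (submod_incl _), c; split=> //.
  exact: short_exact_ker.
pose t := mklin (comp_linear p (mklin (comp_linear q (submod_incl (ker_submod c))))).
have pqj := exact_at0 exq.
have [|j' j'E] := @lin_factor _ _ _ _ j (submod_incl (ker_submod c)) (@submod_incl_inj _ _ _ _).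
  move=> x; have cx : c (j x) = 0 by rewrite /= pqj linear0.
  by exists (Submod (ker_submod c) cx).
apply: (@pd_le_horseshoe _ _ _ _ _ j' t) hN1 (pd_le_leq (leq0n n) pP); split.
- by move=> x y /(congr1 (submod_incl (ker_submod c))); rewrite !j'E => /inj_j.
- move=> z; have [y yE] := surj_q (s z).
  have cy : c y = 0.
    by rewrite /= yE; apply: inj_i; rewrite rE /= sK subrr linear0.
  by exists (Submod (ker_submod c) cy); rewrite /= yE sK.
- move=> x; split=> [/= tx|[y <-]]; last first.
    by rewrite /t /= -submod_inclE j'E pqj linear0.
  have /exq [y yE] : q (val x) = 0.
    have := rE (q (val x)); rewrite /= tx linear0 subr0 => <-.
    by rewrite (_ : r _ = 0) ?linear0 //; exact: (submodP x).
  by exists y; apply: submod_incl_inj; rewrite j'E.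
Qed.

(* Schanuel: compare both projective covers through their fibre product. *)
Lemma pd_le_syzygy n M N P (i : {linear N -> P}) (p : {linear P -> M}) :
  short_exact i p -> projective P -> pd_le n.+1 M -> pd_le n N.
Proof.
move=> [inj_i surj_p ex] pP.
case=> P' [N' [i' [p' [pP' [inj_i' surj_p' ex'] hN']]]].
have neg_lin : linear (fun x => - p' x) by move=> a x y; rewrite !linearP.
pose c := pair_fun p (mklin neg_lin).
pose X := submod (ker_submod c).
have cE (x : X) : p (val x).1 = p' (val x).2.
  by apply/eqP; rewrite -subr_eq0; apply/eqP/(submodP x).
have inX a b : p a = p' b -> exists x : X, val x = (a, b).
  move=> e; have cx : c (a, b) = 0 by rewrite /= e subrr.
  by exists (Submod (ker_submod c) cx).
pose p1 := mklin (comp_linear (mklin (@fst_linear _ P P')) (submod_incl (ker_submod c))).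
pose p2 := mklin (comp_linear (mklin (@snd_linear _ P P')) (submod_incl (ker_submod c))).
have pi0 := exact_at0 ex; have pi'0 := exact_at0 ex'.
have [|j jE] := @lin_factor _ _ _ _ (mklin (comp_linear (mklin (@inl_linear _ P P')) i))
    (submod_incl (ker_submod c)) (@submod_incl_inj _ _ _ _).
  by move=> x; apply: inX; rewrite pi0 linear0.
have [|j' j'E] := @lin_factor _ _ _ _ (mklin (comp_linear (mklin (@inr_linear _ P P')) i'))
    (submod_incl (ker_submod c)) (@submod_incl_inj _ _ _ _).
  by move=> x; apply: inX; rewrite pi'0 linear0.
have ses1 : short_exact j' p1.
  split.
  - move=> x y /(congr1 (submod_incl (ker_submod c))); rewrite !j'E /=.
    by move=> [] /inj_i'.
  - by move=> a; have [b bE] := surj_p' (p a); have [x xE] := inX a b (esym bE); exists x; rewrite /= xE.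
  - move=> x; split=> [/= x1|[y <-]]; last by rewrite /= -submod_inclE j'E.
    have /ex' [y yE] : p' (val x).2 = 0 by rewrite -cE x1 linear0.
    exists y; apply: submod_incl_inj; rewrite j'E /= yE.
    by rewrite [RHS]surjective_pairing x1.
have ses2 : short_exact j p2.
  split.
  - move=> x y /(congr1 (submod_incl (ker_submod c))); rewrite !jE /=.
    by move=> [] /inj_i.
  - by move=> b; have [a aE] := surj_p (p' b); have [x xE] := inX a b aE; exists x; rewrite /= xE.
  - move=> x; split=> [/= x2|[y <-]]; last by rewrite /= -submod_inclE jE.
    have /ex [y yE] : p (val x).1 = 0 by rewrite cE x2 linear0.
    exists y; apply: submod_incl_inj; rewrite jE /= yE.
    by rewrite [RHS]surjective_pairing x2.
(* [ses1] bounds the fibre product as an extension of [P] by [N']; [ses2] makes [N] a summand of it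
   with complement [P']. *)
apply: (pd_le_splitl ses2) => //.
exact: pd_le_horseshoe ses1 hN' (pd_le_leq (leq0n n) pP).
Qed.

Lemma pdim_of_pd n M : pd_le n M -> pdim_le M n.
Proof.
elim: n M => [|n IH] M.
  (* The positive degrees are filled with the zero submodule of [M]. *)
  move=> pM; have Z_sub : @is_submod A M (fun x => x = 0).
    by split=> // a x y -> ->; rewrite scaler0 addr0.
  have Z0 (x : submod Z_sub) : x = 0 by apply: val_inj; exact: (submodP x).
  pose Ps (i : nat) : lmodType A := if i is 0%N then M else submod Z_sub.
  have zero_lin i : linear (fun _ : Ps i.+1 => 0 : Ps i).
    by move=> a x y; rewrite scaler0 addr0.
  exists Ps, (fun i => mklin (zero_lin i)), (mklin (@id_linear _ M)); split=> //.
  - by case=> // i; apply: projective0.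
  - by move=> x; exists x.
  - by move=> x /=; split=> [->|[_ <-//]]; exists 0.
  - by move=> i x; split=> [_|_] //; exists 0; rewrite [x]Z0.
  - by case=> // i _ x; exact: Z0.
case=> P [N [i [p [pP [inj_i surj_p ex]]]]] /IH.
case=> Q [d [e [pQ surj_e ex_e ex_d Q0]]].
(* The resolution of [N] is shifted up by one degree and spliced with [P] in degree 0. *)
pose Ps (k : nat) : lmodType A := if k is k'.+1 then Q k' else P.
pose ds k : {linear Ps k.+1 -> Ps k} :=
  match k return {linear Ps k.+1 -> Ps k} with
  | 0%N => mklin (comp_linear i e)
  | k'.+1 => d k'
  end.
exists Ps, ds, p; split=> //.
- by case.
- move=> x; rewrite ex; split=> [[y <-]|[y <-]]; last by exists (e y).
  by have [z <-] := surj_e y; exists z.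
- case=> //= x; rewrite -ex_e; split=> [|->]; last exact: linear0.
  by rewrite -(linear0 i) => /inj_i.
- by case=> // k; rewrite ltnS => /Q0.
Qed.

Lemma pd_of_pdim n M : pdim_le M n -> pd_le n M.
Proof.
elim: n M => [|n IH] M [P [d [e [pP surj_e ex_e ex_d P0]]]].
  apply: (@pd_le_iso _ 0 _ _ e) => //; last exact: pP.
  move=> x y exy; apply/eqP; rewrite -subr_eq0; apply/eqP.
  have /ex_e [z <-] : e (x - y) = 0 by rewrite linearB exy subrr.
  by rewrite (P0 1%N _ z) ?linear0.
exists (P 0%N), (submod (ker_submod e)), (submod_incl _), e; split=> //.
  exact: short_exact_ker.
apply: IH.
have [|f fE] := @lin_factor _ _ _ _ (d 0%N) (submod_incl (ker_submod e)) (@submod_incl_inj _ _ _ _).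
  move=> x; have ex : e (d 0%N x) = 0 by apply/ex_e; exists x.
  by exists (Submod (ker_submod e) ex).
exists (fun k => P k.+1), (fun k => d k.+1), f; split=> //.
- by move=> y; have /ex_e [x xE] := submodP y; exists x; apply: submod_incl_inj; rewrite fE.
- move=> x; rewrite -ex_d -fE; split=> [->|]; first exact: linear0.
  by rewrite -(linear0 (submod_incl (ker_submod e))) => /submod_incl_inj.
- by move=> k lk; apply: P0.
Qed.

Lemma gldim_finiteE : gldim_finite A <-> exists n, forall M : lmodType A, pd_le n M.
Proof.
by split=> -[n h]; exists n => M; [exact: pd_of_pdim|exact: pdim_of_pd].
Qed.
End ProjectiveDimension.

(** * Direct sums of modules *)

Section DirectSum.
Variables (A : pzRingType) (T : eqType).

Section Product.
Variable M : T -> lmodType A.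

Definition dprod := forall t, M t.
HB.instance Definition _ := gen_eqMixin dprod.
HB.instance Definition _ := gen_choiceMixin dprod.

Let extP (f g : dprod) : (forall t, f t = g t) -> f = g.
Proof. exact: functional_extensionality_dep. Qed.

Definition dprod_zero : forall t, M t := fun t => 0.
Definition dprod_opp (f : dprod) : dprod := fun t => - f t.
Definition dprod_add (f g : dprod) : dprod := fun t => f t + g t.
Definition dprod_scale (a : A) (f : dprod) : dprod := fun t => a *: f t.

Lemma dprod_addA : associative dprod_add.
Proof. by move=> f g h; apply: extP => t; exact: addrA. Qed.
Lemma dprod_addC : commutative dprod_add.
Proof. by move=> f g; apply: extP => t; exact: addrC. Qed.
Lemma dprod_add0 : left_id dprod_zero dprod_add.
Proof. by move=> f; apply: extP => t; exact: add0r. Qed.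
Lemma dprod_addN : left_inverse dprod_zero dprod_opp dprod_add.
Proof. by move=> f; apply: extP => t; exact: addNr. Qed.
HB.instance Definition _ := GRing.isZmodule.Build dprod
  dprod_addA dprod_addC dprod_add0 dprod_addN.

Lemma dprod_scaleA a b f : dprod_scale a (dprod_scale b f) = dprod_scale (a * b) f.
Proof. by apply: extP => t; exact: scalerA. Qed.
Lemma dprod_scale1 : left_id 1 dprod_scale.
Proof. by move=> f; apply: extP => t; exact: scale1r. Qed.
Lemma dprod_scaleDr : right_distributive dprod_scale +%R.
Proof. by move=> a f g; apply: extP => t; exact: scalerDr. Qed.
Lemma dprod_scaleDl f : {morph dprod_scale^~ f : a b / a + b}.
Proof. by move=> a b; apply: extP => t; exact: scalerDl. Qed.
HB.instance Definition _ := GRing.Zmodule_isLmodule.Build A dprod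
  dprod_scaleA dprod_scale1 dprod_scaleDr dprod_scaleDl.

Definition fin_supp (f : dprod) : Prop :=
  exists s : seq T, forall t, t \notin s -> f t = 0.

Lemma fin_supp_submod : is_submod fin_supp.
Proof.
split=> [|a f g [s sE] [r rE]]; first by exists [::].
exists (s ++ r) => t; rewrite mem_cat negb_or => /andP[/sE ft /rE gt].
by rewrite [LHS](_ : _ = a *: f t + g t) // ft gt scaler0 addr0.
Qed.

(** The index type may be infinite, because an arbitrary module killed by the radical can have
    infinitely many simple summands. *)
Definition dsum := submod fin_supp_submod.
HB.instance Definition _ := GRing.Lmodule.on dsum.

Definition coord (t : T) (f : dsum) : M t := (val f) t.

Lemma coord_linear t : linear (coord t). Proof. by []. Qed.
HB.instance Definition _ t := GRing.isLinear.Build A dsum (M t) *:%R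
  (coord t) (coord_linear t).

Lemma dsum_ext (f g : dsum) : (forall t, coord t f = coord t g) -> f = g.
Proof. by move=> e; apply/val_inj/extP. Qed.

Lemma dsum_of (s : seq T) (f : forall t, M t) :
  (forall t, t \notin s -> f t = 0) -> exists g : dsum, forall t, coord t g = f t.
Proof.
move=> sf; have fs : fin_supp f by exists s.
by exists (Submod fin_supp_submod fs).
Qed.

Lemma delta_supp t (m : M t) : fin_supp (dfwith dprod_zero m).
Proof.
by exists [:: t] => t'; rewrite inE => tt'; rewrite dfwith_out // eq_sym.
Qed.
Definition delta t (m : M t) : dsum := Submod fin_supp_submod (delta_supp m).

Lemma coord_delta t m : coord t (@delta t m) = m.
Proof. exact: dfwith_in. Qed.
Lemma coord_deltaN t t' (m : M t) : t != t' -> coord t' (delta m) = 0.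
Proof. by move=> tt'; apply: dfwith_out. Qed.

Lemma delta_linear t : linear (@delta t).
Proof.
move=> a x y; apply: dsum_ext => t'; rewrite linearP /=.
have [<-|tt'] := eqVneq t t'; first by rewrite !coord_delta.
by rewrite !coord_deltaN // scaler0 addr0.
Qed.

Section Copairing.
Variables (N : lmodType A) (phi : forall t, {linear M t -> N}).

(** Some finite list containing the support, possibly larger than it; [copairE] shows that the
    choice does not affect [copair]. *)
Definition supp (f : dsum) : seq T := undup (projT1 (cid (submodP f))).

Lemma suppP f t : t \notin supp f -> coord t f = 0.
Proof. by rewrite mem_undup => /(projT2 (cid (submodP f))). Qed.

Definition copair (f : dsum) : N := \sum_(t <- supp f) phi t (coord t f).

Lemma copairE (s : seq T) f : uniq s -> (forall t, t \notin s -> coord t f = 0) ->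
  copair f = \sum_(t <- s) phi t (coord t f).
Proof.
move=> us sP; have := @suppP f; have := undup_uniq (projT1 (cid (submodP f))).
rewrite -/(supp f) /copair; move: (supp f) => r ur rP.
pose F t := phi t (coord t f).
have restrict (s1 s2 : seq T) : (forall t, t \notin s2 -> coord t f = 0) ->
    \sum_(t <- s1) F t = \sum_(t <- [seq t <- s1 | t \in s2]) F t.
  move=> s2P; rewrite big_filter [RHS]big_mkcond; apply: eq_bigr => t _.
  by case: ifPn => // /s2P ft; rewrite /F ft linear0.
rewrite [LHS](restrict _ s) // [RHS](restrict _ r) //.
apply: perm_big; apply: uniq_perm; rewrite ?filter_uniq // => t.
by rewrite !mem_filter andbC.
Qed.

Lemma copair_linear : linear copair.
Proof.
move=> a f g; pose s := undup (supp f ++ supp g).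
have sP h : {subset supp h <= s} -> forall t, t \notin s -> coord t h = 0.
  by move=> sub t ts; apply: suppP; apply: contra ts => /sub.
have sf := sP f; have sg := sP g.
have {}sf : forall t, t \notin s -> coord t f = 0.
  by apply: sf => t tf; rewrite mem_undup mem_cat tf.
have {}sg : forall t, t \notin s -> coord t g = 0.
  by apply: sg => t tg; rewrite mem_undup mem_cat tg orbT.
rewrite !(@copairE s) ?undup_uniq //; last first.
  by move=> t ts; rewrite linearP /= sf // sg // scaler0 addr0.
by rewrite scaler_sumr -big_split; apply: eq_bigr => t _; rewrite !linearP.
Qed.

Lemma copair_delta t m : copair (@delta t m) = phi t m.
Proof.
rewrite (@copairE [:: t]) // ?big_seq1 ?coord_delta // => t'.
by rewrite inE => tt'; rewrite coord_deltaN // eq_sym.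
Qed.

End Copairing.

Lemma dsum_decomp (f : dsum) : f = \sum_(t <- supp f) delta (coord t f).
Proof.
rewrite -[RHS](copairE (fun t => mklin (@delta_linear t)) (undup_uniq _) (@suppP f)).
apply: dsum_ext => t; rewrite /copair linear_sum /=.
have [ts|tNs] := boolP (t \in supp f).
  rewrite (bigD1_seq t) ?undup_uniq //= coord_delta big1 ?addr0 // => t' tt'.
  exact: coord_deltaN.
rewrite (suppP tNs) big_seq big1 // => t' ts; apply: coord_deltaN.
by apply: contraNneq tNs => <-.
Qed.

Lemma projective_dsum : (forall t, projective (M t)) -> projective dsum.
Proof.
move=> pM X Y g f surj.
have {pM} lift t := pM t _ _ g (mklin (comp_linear f (mklin (@delta_linear t)))) surj.
pose h t := projT1 (cid (lift t)).
have hE t x : g (h t x) = f (delta x) by exact: (projT2 (cid (lift t))).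
exists (mklin (copair_linear h)) => x /=.
rewrite [in RHS](dsum_decomp x) /copair !linear_sum; apply: eq_bigr => t _.
exact: hE.
Qed.

End Product.

Section Componentwise.
Variables (M N : T -> lmodType A) (phi : forall t, {linear M t -> N t}).

Lemma dsum_map_supp (f : dsum M) : fin_supp (fun t => phi t (coord t f) : N t).
Proof. by exists (supp f) => t /suppP ->; rewrite linear0. Qed.

Definition dsum_map (f : dsum M) : dsum N := Submod (fin_supp_submod N) (dsum_map_supp f).

Lemma coord_map t f : coord t (dsum_map f) = phi t (coord t f).
Proof. by []. Qed.

Lemma dsum_map_linear : linear dsum_map.
Proof. by move=> a f g; apply: dsum_ext => t; rewrite linearP !coord_map !linearP. Qed.

End Componentwise.

Lemma dsum_short_exact (M N P : T -> lmodType A)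
    (i : forall t, {linear N t -> P t}) (p : forall t, {linear P t -> M t}) :
  (forall t, short_exact (i t) (p t)) ->
  short_exact (mklin (dsum_map_linear i)) (mklin (dsum_map_linear p)).
Proof.
move=> ses; split.
- move=> f g e; apply: dsum_ext => t; have [inj_i _ _] := ses t; apply: inj_i.
  exact: (congr1 (fun h => coord t h) e).
(* The preimage is required to be 0 wherever [y] is, so that the chosen family has finite
   support. *)
- move=> y; have pre t : exists x, p t x = coord t y /\ (coord t y = 0 -> x = 0).
    have [_ surj_p _] := ses t; have [-> | ny] := pselect (coord t y = 0).
      by exists 0; rewrite linear0.
    by have [x xE] := surj_p (coord t y); exists x.
  pose x t := projT1 (cid (pre t)).
  have xE t : p t (x t) = coord t y /\ (coord t y = 0 -> x t = 0) by exact: (projT2 (cid (pre t))).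
  have [|f fE] := @dsum_of P (supp y) x.
    by move=> t /suppP yt; case: (xE t) => _; apply.
  by exists f; apply: dsum_ext => t; rewrite coord_map fE; case: (xE t).
- move=> x; split=> [px|[y <-]]; last first.
    by apply: dsum_ext => t; rewrite !coord_map linear0; have [_ _ ex] := ses t; exact: exact_at0.
  have pre t : exists y, i t y = coord t x.
    by have [_ _ ex] := ses t; apply/ex; rewrite -coord_map (_ : dsum_map p x = 0) ?linear0.
  pose y t := projT1 (cid (pre t)).
  have yE t : i t (y t) = coord t x by exact: (projT2 (cid (pre t))).
  have [|f fE] := @dsum_of N (supp x) y.
    move=> t /suppP xt; have [inj_i _ _] := ses t.
    by apply: inj_i; rewrite yE xt linear0.
  by exists f; apply: dsum_ext => t; rewrite coord_map fE yE.
Qed.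

Lemma pd_le_dsum n (M : T -> lmodType A) : (forall t, pd_le n (M t)) -> pd_le n (dsum M).
Proof.
elim: n M => [|n IH] M; first exact: projective_dsum.
move=> /= h; pose P t := projT1 (cid (h t)); pose h1 t := projT2 (cid (h t)).
pose N t := projT1 (cid (h1 t)); pose h2 t := projT2 (cid (h1 t)).
pose i t := projT1 (cid (h2 t)); pose h3 t := projT2 (cid (h2 t)).
pose p t := projT1 (cid (h3 t)); have h4 t := projT2 (cid (h3 t)).
exists (dsum P), (dsum N), (mklin (dsum_map_linear i)), (mklin (dsum_map_linear p)).
split.
- by apply: projective_dsum => t; case: (h4 t).
- by apply: dsum_short_exact => t; case: (h4 t).
- by apply: IH => t; case: (h4 t).
Qed.

(** The conditions on [copair phi] say that [N] is the internal direct sum of the images of the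
    [M t]. *)
Lemma pd_le_internal n (M : T -> lmodType A) (N : lmodType A)
    (phi : forall t, {linear M t -> N}) :
  (forall f, copair phi f = 0 -> f = 0) -> surjective (copair phi) ->
  (forall t, pd_le n (M t)) -> pd_le n N.
Proof.
move=> inj surj /pd_le_dsum; apply: (@pd_le_iso _ _ _ _ (mklin (copair_linear phi))) => //.
move=> f g e; apply/eqP; rewrite -subr_eq0; apply/eqP/inj.
transitivity (copair phi f - copair phi g); last by rewrite [copair phi f]e subrr.
exact: (linearB (mklin (copair_linear phi))).
Qed.

End DirectSum.

(** * Quotient and cyclic modules *)

Section QuotientModule.
Variables (A : pzRingType) (M : lmodType A) (S : M -> Prop) (hS : is_submod S).
Local Open Scope quotient_scope.

Definition quotm := Quotient.quot (submod_pred hS).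
HB.instance Definition _ := GRing.Zmodule.on quotm.
HB.instance Definition _ : EqQuotient M (Quotient.equiv (submod_pred hS)) quotm
  := EqQuotient.on quotm.

Lemma quotm_piE (x y : M) : \pi_quotm x = \pi_quotm y <-> S (x - y).
Proof.
have e : (\pi_quotm x == \pi_quotm y) = (x - y \in submod_pred hS).
  by rewrite [RHS]Quotient.idealrBE.
split=> [/eqP|h]; first by rewrite e => /asboolP.
by apply/eqP; rewrite e; apply/asboolP.
Qed.

Definition quotm_scale (a : A) (x : quotm) : quotm := \pi_quotm (a *: repr x).

Lemma quotm_scaleE a x : quotm_scale a (\pi x) = \pi_quotm (a *: x).
Proof.
apply/quotm_piE; rewrite -scalerBr.
have [_ hD] := hS; rewrite -[_ *: _]addr0; apply: hD; last by case: hS.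
by apply/quotm_piE; rewrite reprK.
Qed.

Lemma quotm_piD (x y : M) : \pi_quotm (x + y) = \pi x + \pi y.
Proof. exact: Quotient.pi_add. Qed.

Lemma quotm_scaleA a b x : quotm_scale a (quotm_scale b x) = quotm_scale (a * b) x.
Proof. by rewrite -[x]reprK !quotm_scaleE scalerA. Qed.
Lemma quotm_scale1 : left_id 1 quotm_scale.
Proof. by move=> x; rewrite -[x]reprK quotm_scaleE scale1r. Qed.
Lemma quotm_scaleDr : right_distributive quotm_scale +%R.
Proof.
move=> a x y; rewrite -[x]reprK -[y]reprK -quotm_piD !quotm_scaleE scalerDr.
exact: quotm_piD.
Qed.
Lemma quotm_scaleDl x : {morph quotm_scale^~ x : a b / a + b}.
Proof.
by move=> a b; rewrite -[x]reprK !quotm_scaleE scalerDl; exact: quotm_piD.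
Qed.
HB.instance Definition _ := GRing.Zmodule_isLmodule.Build A quotm
  quotm_scaleA quotm_scale1 quotm_scaleDr quotm_scaleDl.

Definition quotm_proj (x : M) : quotm := \pi x.

Lemma quotm_proj_linear : linear quotm_proj.
Proof.
by move=> a x y; rewrite /quotm_proj quotm_piD -quotm_scaleE.
Qed.

Lemma quotm_proj_surj : surjective quotm_proj.
Proof. by move=> x; exists (repr x); apply: reprK. Qed.

Lemma quotm_short_exact : short_exact (submod_incl hS) (mklin quotm_proj_linear).
Proof.
split; [exact: submod_incl_inj|exact: quotm_proj_surj|move=> x].
have e : quotm_proj x = 0 <-> S x.
  rewrite -[x in S x]subr0 -quotm_piE /quotm_proj (_ : \pi 0 = 0) //.
  exact: (linear0 (mklin quotm_proj_linear)).
by rewrite /= e; split=> [Sx|[y <-]]; [exists (Submod hS Sx)|exact: submodP].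
Qed.

End QuotientModule.

Lemma projective_regular (A : pzRingType) : projective (A^o : lmodType A).
Proof.
move=> M N g f surj; have [m mE] := surj (f 1).
have lin : linear (fun b : A^o => (b : A) *: m) by move=> a x y; rewrite scalerDl scalerA.
exists (mklin lin) => x /=; rewrite linearZ_LR mE -linearZ_LR.
by congr (f _); rewrite /GRing.scale /= mulr1.
Qed.

Section LeftIdeal.
Variables (A : pzRingType).

Lemma scale_linear (M : lmodType A) (m : M) : linear (fun b : A^o => (b : A) *: m).
Proof. by move=> a x y; rewrite scalerDl scalerA. Qed.

Definition cyc (M : lmodType A) (m : M) : lmodType A :=
  submod (range_submod (mklin (scale_linear m))).

Lemma cycP (M : lmodType A) (m : M) (x : cyc m) : exists b, val x = b *: m.
Proof. by have [b bE] := submodP x; exists b. Qed.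

Lemma cyc_mem (M : lmodType A) (m : M) b : exists x : cyc m, val x = b *: m.
Proof.
have h : exists b', b *: m = mklin (scale_linear m) b' by exists b.
by exists (Submod (range_submod (mklin (scale_linear m))) h).
Qed.

(** Right multiplication by [e] retracts the regular module onto [A e]. *)
Lemma projective_cyc (e : A) : e * e = e -> projective (cyc (e : A^o)).
Proof.
move=> ee.
have [|r rE] := @lin_factor _ _ _ _ (mklin (scale_linear (e : A^o)))
    (submod_incl (range_submod (mklin (scale_linear (e : A^o)))))
    (@submod_incl_inj _ _ _ _).
  by move=> b; exact: cyc_mem.
apply: (@projective_retract _ _ A^o (submod_incl _) r); last exact: projective_regular.
move=> x; apply: submod_incl_inj; rewrite rE /=.
have [b ->] := cycP x; rewrite /GRing.scale /=.
by rewrite -mulrA ee.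
Qed.

(** The map [A e -> A m] sends [b] to [b *: m]. It is onto since [e *: m = m], and [f] identifies
    [N] with its kernel, the annihilator of [m] in [A e]. *)
Lemma cyc_short_exact (M N : lmodType A) (e : A) (m : M) (f : {linear N -> A^o}) :
  e *: m = m -> e * e = e -> injective f ->
  (forall b, b * e = b -> b *: m = 0 <-> exists y, f y = b) ->
  (forall y, f y * e = f y) ->
  exists (i : {linear N -> cyc (e : A^o)}) (p : {linear cyc (e : A^o) -> cyc m}),
    short_exact i p /\ forall x, val (p x) = (val x : A) *: m.
Proof.
move=> em ee inj_f ker fe.
have inj_v := @submod_incl_inj A.
have [|i iE] := @lin_factor _ _ _ _ f
    (submod_incl (range_submod (mklin (scale_linear (e : A^o))))) (@inj_v _ _ _).
  by move=> y; have [x xE] := cyc_mem (e : A^o) (f y); exists x; rewrite /= xE; exact: fe.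
have [|p pE] := @lin_factor _ _ _ _ (mklin (comp_linear (mklin (scale_linear m))
      (submod_incl (range_submod (mklin (scale_linear (e : A^o)))))))
    (submod_incl (range_submod (mklin (scale_linear m)))) (@inj_v _ _ _).
  by move=> x; exact: cyc_mem.
exists i, p; split; last by move=> x; exact: pE.
split.
- by move=> x y exy; apply: inj_f; rewrite -!iE exy.
- move=> y; have [b bE] := cycP y; have [x xE] := cyc_mem (e : A^o) b.
  exists x; apply: inj_v; rewrite pE /= [val x](xE : _ = b * e :> A) bE.
  by rewrite -scalerA em.
- move=> x; have xe : (val x : A) * e = val x.
    by have [b ->] := cycP x; rewrite /GRing.scale /= -mulrA ee.
  have px0 : p x = 0 <-> (val x : A) *: m = 0.
    split=> [px|xm]; first by rewrite -[LHS](pE x) px linear0.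
    by apply: inj_v; rewrite pE linear0.
  rewrite px0 ker //; split=> -[y yE]; exists y.
    by apply: inj_v; rewrite iE yE.
  by rewrite -iE yE.
Qed.

End LeftIdeal.

(** * A criterion for finite global dimension *)

Section Criterion.
Variables (B : pzRingType) (X V : finType).
(** In the application [g x] is the signed sum of the arrows with label [x], [e x] is the idempotent
    of its targets, [E v] is a vertex idempotent, and [inc x v] says that [v] is a source of [x].
    The relations are the products [g y * g x] with [sigma x = Some y], and [J] is the radical. *)
Variables (g e : X -> B) (E : V -> B) (inc : X -> pred V) (sigma : X -> option X).
Variable J : B -> Prop.
Hypothesis J_ideal : two_sided_ideal J.
Hypothesis J_nil : exists m, forall s : seq B,
  size s = m -> (forall b, b \in s -> J b) -> \prod_(b <- s) b = 0.
Hypothesis J_g : forall x, J (g x).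
Hypothesis J_e : forall x, ~ J (e x).
Hypothesis e_idem : forall x, e x * e x = e x.
Hypothesis e_g : forall x, e x * g x = g x.
Hypothesis g_sigma : forall x y, sigma x = Some y -> g y * g x = 0 /\ g y * e x = g y.
Hypothesis inc_ex : forall x, exists v, inc x v.
Hypothesis g_inc : forall x v, ~~ inc x v -> g x * E v = 0.
Hypothesis E_sum : \sum_v E v = 1.
Hypothesis E_idem : forall v, E v * E v = E v.
Hypothesis E_local : forall v b, b * E v = b -> J b \/ exists b', J (E v - b' * b).
Hypothesis J_gen : forall v b, J b -> b * E v = b ->
  exists c : X -> B, b = \sum_x c x * g x * E v.

(** The expected annihilator of [g x] inside [B e_x]: the left ideal [B g_y], or zero if no relation
    continues [x]. *)
Definition in_syz (x : X) (b : B) : Prop :=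
  if sigma x is Some y then exists d, b = d * g y else b = 0.

(** Two facts in one: with a single nonzero coefficient it computes annihilators ([syz1]), and with
    several it makes the sum of the left ideals [B g_x E_v] direct (through [in_syz_g]). *)
Hypothesis syz : forall v c, \sum_x c x * g x * E v = 0 ->
  forall x, inc x v -> in_syz x (c x * e x).

Lemma syz1 x v b : inc x v -> b * g x * E v = 0 -> in_syz x (b * e x).
Proof.
move=> xv bx; have := @syz v (fun x' => if x' == x then b else 0) _ x xv.
rewrite eqxx; apply; rewrite (bigD1 x) //= eqxx bx add0r big1 // => x' /negPf ->.
by rewrite !mul0r.
Qed.

Lemma in_syz_g x b : in_syz x (b * e x) -> b * g x = 0.
Proof.
rewrite -e_g mulrA /in_syz; case s: (sigma x) => [y|] => [[d ->]|->].
  by rewrite -mulrA (g_sigma s).1 mulr0.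
by rewrite mul0r.
Qed.

(** If [g x] vanished, 1 would annihilate it, and [e x] would lie in [B g_y] or be zero, hence lie
    in [J]. *)
Lemma g_neq0 x : g x <> 0.
Proof.
move=> gx; have [v xv] := inc_ex x; case: J_ideal => J0 _ JM.
have := @syz1 x v 1 xv; rewrite gx mulr0 mul0r mul1r => /(_ erefl).
rewrite /in_syz; case s: (sigma x) => [y|] => [[d ed]|ex]; apply: (@J_e x).
  by rewrite ed -[X in J X]mulr1; apply: JM; exact: J_g.
by rewrite ex.
Qed.

Definition Lid (a : B) : lmodType B := cyc (a : B^o).

Lemma LidP a (z : Lid a) : exists b, (val z : B) = b * a.
Proof. by have [b bE] := cycP z; exists b; exact: bE. Qed.

Lemma Lid_mem a b : exists z : Lid a, (val z : B) = b * a.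
Proof. by have [z zE] := cyc_mem (a : B^o) b; exists z; exact: zE. Qed.

(** The factor [u] is 1 when treating [B g_x] itself and [E v] when treating a summand of the
    radical. *)
Lemma Lid_short_exact x y u : sigma x = Some y ->
  (forall b, b * (g x * u) = 0 -> in_syz x (b * e x)) ->
  exists (i : {linear Lid (g y) -> Lid (e x)}) (p : {linear Lid (e x) -> Lid (g x * u)}),
    short_exact i p /\ forall z, val (p z) = (val z : B) * (g x * u).
Proof.
move=> s hu; have [gg ge] := g_sigma s.
have fE (z : Lid (g y)) : exists d, (val z : B) = d * g y by exact: LidP.
apply: (cyc_short_exact (m := (g x * u) : B^o) (f := submod_incl _)) => //.
- by rewrite /GRing.scale /= mulrA e_g.
- exact: submod_incl_inj.
- move=> b be; rewrite /GRing.scale /=; split=> [/hu|[z <-]].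
    rewrite /in_syz s be => -[d ->].
    by have [z zE] := Lid_mem (g y) d; exists z.
  by have [d dE] := fE z; rewrite /= dE -mulrA [g y * _]mulrA gg mul0r mulr0.
- by move=> z; have [d /= ->] := fE z; rewrite -mulrA ge.
Qed.

Lemma idem_nil z : J z -> z * z = z -> z = 0.
Proof.
have [m mP] := J_nil => Jz zz; have := mP (nseq m.+1 z).
case: m mP => [|m] mP.
  (* For [m = 0] the empty product already gives [1 = 0]. *)
  have := mP [::] erefl; rewrite big_nil => one0 _.
  by rewrite -[z]mulr1 one0 ?mulr0.
have prodE k : \prod_(b <- nseq k.+1 z) b = z.
  elim: k => [|k IH]; first by rewrite big_seq1.
  by rewrite -[nseq _ _]/(z :: nseq k.+1 z) big_cons IH.
move=> _; rewrite -(prodE m); apply: mP; first by rewrite size_nseq.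
by move=> b; rewrite mem_nseq => /andP[_ /eqP ->].
Qed.

(** A section sends the generator [g x] to some [u] in [B e_x], and [e x - u] is an idempotent in
    the nilpotent ideal [J], hence 0. Then [g y = g y * e x = g y * u], which is 0 because
    [g y * g x = 0]; this contradicts [g_neq0]. *)
Lemma Lid_not_projective x y : sigma x = Some y -> ~ projective (Lid (g x)).
Proof.
move=> s pr; have [gg ge] := g_sigma s; have [v xv] := inc_ex x.
case: J_ideal => J0 JD JM.
have hu b : b * g x = 0 -> in_syz x (b * e x).
  by move=> bg; apply: (syz1 xv); rewrite bg mul0r.
have hu1 b : b * (g x * 1) = 0 -> in_syz x (b * e x) by rewrite mulr1; exact: hu.
have [i [p [[_ surj_p _] pE]]] := Lid_short_exact s hu1.
rewrite -[g x]mulr1 in pr.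
have [t tK] := projective_split pr surj_p.
have [G GE] : exists G : Lid (g x * 1), (val G : B) = g x.
  by have [G GE] := Lid_mem (g x * 1) 1; exists G; rewrite GE mul1r mulr1.
pose u : B := val (t G).
have ug : u * g x = g x by rewrite -{1}[g x]mulr1 -[LHS](pE (t G)) tK.
have ue : u * e x = u.
  by have [b bE] := LidP (t G); rewrite /u bE -mulrA e_idem.
(* By linearity of the section, whatever kills the generator kills its image. *)
have ann b : b * g x = 0 -> b * u = 0.
  move=> bg; rewrite -[LHS]/(val (b *: t G)) -linearZ_LR (_ : b *: G = 0) ?linear0 //.
  by apply: val_inj; rewrite -[LHS]/(b * (val G : B)) GE.
pose z := e x - u.
have zg : z * g x = 0 by rewrite mulrBl e_g ug subrr.
have ze : z * e x = z by rewrite mulrBl e_idem ue.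
have Jz : J z.
  have := hu _ zg; rewrite ze /in_syz s => -[d ->].
  by rewrite -[X in J X]mulr1; apply: JM; exact: J_g.
have zz : z * z = z by rewrite {2}/z mulrBr ze ann ?subr0.
have := idem_nil Jz zz => /eqP; rewrite subr_eq0 => /eqP eu.
by apply: (@g_neq0 y); rewrite -ge eu ann.
Qed.

Lemma sigma_iterS k x y : sigma x = Some y ->
  iter k.+1 (obind sigma) (Some x) = iter k (obind sigma) (Some y).
Proof. by rewrite iterSr /= => ->. Qed.

(** [B g_y] is a syzygy of [B g_x], so each step along [sigma] lowers the bound by one, until some
    [B g_x] with a successor would be projective. *)
Lemma gldim_infinite x n : (forall k, iter k (obind sigma) (Some x) <> None) ->
  ~ pd_le n (Lid (g x)).
Proof.
elim: n x => [|n IH] x xP hx.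
  have := xP 1%N => /=; case s: (sigma x) => [y|] // _.
  exact: Lid_not_projective s hx.
have := xP 1%N => /=; case s: (sigma x) => [y|] // _.
have hu1 b : b * (g x * 1) = 0 -> in_syz x (b * e x).
  by have [v xv] := inc_ex x; rewrite mulr1 => bg; apply: (syz1 xv); rewrite bg mul0r.
have [i [p [ses _]]] := Lid_short_exact s hu1.
apply: (IH y); first by move=> k; rewrite -(sigma_iterS k s).
by apply: (pd_le_syzygy ses (projective_cyc (e_idem x))); rewrite mulr1.
Qed.

Lemma pd_le_Lid n x u : (forall b, b * (g x * u) = 0 -> in_syz x (b * e x)) ->
  (forall y, sigma x = Some y -> pd_le n (Lid (g y))) -> pd_le n.+1 (Lid (g x * u)).
Proof.
move=> hu hy; case s: (sigma x) => [y|].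
  have [i [p [ses _]]] := Lid_short_exact s hu.
  by exists (Lid (e x)), (Lid (g y)), i, p; split; [exact: projective_cyc|exact: ses|exact: hy].
(* Without a continuing relation the annihilator is zero, so the zero module serves as syzygy. *)
have Z_sub : @is_submod B B^o (fun x => x = 0).
  by split=> // a b c -> ->; rewrite scaler0 addr0.
have [|||||i [p [ses _]]] := cyc_short_exact (e := e x) (m := (g x * u) : B^o)
    (f := submod_incl Z_sub).
- by rewrite /GRing.scale /= mulrA e_g.
- exact: e_idem.
- exact: submod_incl_inj.
- move=> b be; rewrite /GRing.scale /=; split=> [/hu|[z <-]].
    by rewrite /in_syz s be => ->; exists 0.
  by rewrite (submodP z) mul0r.
- by move=> z; rewrite /= (submodP z) mul0r.
exists (Lid (e x)), (submod Z_sub), i, p; split=> //; first exact: projective_cyc.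
apply: (@pd_le_leq _ 0) => //; apply: projective0 => z.
by apply: val_inj; exact: (submodP z).
Qed.

(** * Finite chains bound the dimension of the radicals of the projectives [B E_v] *)

Section Bounded.
Hypothesis sigma_nil : forall x, exists k, iter k (obind sigma) (Some x) = None.

Lemma pd_le_Lid_bound : exists n, forall x, pd_le n (Lid (g x)).
Proof.
have [k kP] := choice sigma_nil.
have bound m x : iter m (obind sigma) (Some x) = None -> pd_le m (Lid (g x)).
  elim: m x => // m IH x xm; rewrite -[g x]mulr1; apply: pd_le_Lid.
    have [v xv] := inc_ex x; move=> b; rewrite mulr1 => bg.
    by apply: (syz1 xv); rewrite bg mul0r.
  by move=> y s; apply: IH; rewrite -(sigma_iterS m s).
exists (\max_x k x) => x; apply: pd_le_leq (bound _ _ (kP x)).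
exact: leq_bigmax.
Qed.

Lemma rad_submod v : @is_submod B B^o (fun b => J b /\ b * E v = b).
Proof.
case: J_ideal => J0 JD JM; split; first by rewrite mul0r.
move=> a b c [Jb bE] [Jc cE]; rewrite /GRing.scale /=; split.
  by apply: JD => //; rewrite -[a * b]mulr1; apply: JM.
by rewrite mulrDl -mulrA bE cE.
Qed.

(** The radical [J E_v] is the direct sum of the left ideals [B g_x E_v]: [J_gen] shows that they
    span and [syz] that they are independent. Labels [x] without source [v] contribute zero, and the
    others have syzygy [B g_y] or zero. *)
Lemma pd_le_rad : exists n, forall v, pd_le n (submod (rad_submod v)).
Proof.
have [n nP] := pd_le_Lid_bound; exists n.+1 => v.
case: J_ideal => J0 JD JM.
have mem_rad x (z : Lid (g x * E v)) : exists y, submod_incl (rad_submod v) y = val z.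
  have [b bE] := LidP z; have h : J (val z) /\ (val z : B) * E v = val z.
    rewrite bE; split; first by rewrite mulrA; apply: JM; exact: J_g.
    by rewrite -!mulrA E_idem.
  by exists (Submod (rad_submod v) h).
have fac x := @lin_factor _ _ _ _ (submod_incl _) _ (@submod_incl_inj _ _ _ (rad_submod v)) (mem_rad x).
pose phi x := projT1 (cid (fac x)).
have phiE x z : val (phi x z) = val z by exact: (projT2 (cid (fac x)) z).
have copE f : val (copair phi f) = \sum_x (val (coord x f) : B).
  rewrite (@copairE _ _ _ _ _ (index_enum X)) ?index_enum_uniq //.
    by rewrite (linear_sum (submod_incl (rad_submod v))) /=; apply: eq_bigr => x _; rewrite phiE.
  by move=> x; rewrite mem_index_enum.
apply: (pd_le_internal (phi := phi)).
- move=> f /(congr1 val); rewrite copE => f0; apply: dsum_ext => x; rewrite linear0.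
  have coordP x' : exists b, (val (coord x' f) : B) = b * (g x' * E v) by exact: LidP.
  have [c cE] := choice coordP.
  apply: val_inj; rewrite [LHS]cE.
  have [xv|xNv] := boolP (inc x v); last by rewrite g_inc // mulr0.
  rewrite mulrA (_ : c x * g x = 0) ?mul0r //; apply: in_syz_g.
  apply: (@syz v) => //; rewrite -[RHS]f0; apply: eq_bigr => x' _.
  by rewrite cE mulrA.
- move=> y; have [Jy yE] := submodP y; have [c cE] := J_gen Jy yE.
  have pre x : exists z : Lid (g x * E v), val z = c x * (g x * E v) by exact: Lid_mem.
  pose z x := projT1 (cid (pre x)).
  have zE x : val (z x) = c x * (g x * E v) by exact: (projT2 (cid (pre x))).
  have [|f fE] := @dsum_of _ _ _ (index_enum X) z; first by move=> x; rewrite mem_index_enum.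
  exists f; apply: val_inj; rewrite copE cE; apply: eq_bigr => x _.
  by rewrite fE zE mulrA.
- move=> x; have [xv|xNv] := boolP (inc x v); last first.
    apply: (@pd_le_leq _ 0) => //; apply: projective0 => z; apply: val_inj.
    by have [b bE] := LidP z; rewrite [LHS]bE g_inc // mulr0.
  by apply: pd_le_Lid => [b|y _]; [rewrite mulrA; exact: syz1|exact: nP].
Qed.
End Bounded.

(** * From simple modules to semisimple modules to all modules *)

Section Semisimple.
Variable d : nat.
Hypothesis pd_rad : forall v, pd_le d (submod (rad_submod v)).

(** This makes [B t] simple: each of its nonzero elements generates it, because [E_local] inverts
    elements outside [J] modulo [J]. *)
Lemma local_inv (N : lmodType B) (t : N) v b : (forall j, J j -> j *: t = 0) ->
  E v *: t = t -> b *: t <> 0 -> exists b', b' *: (b *: t) = t.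
Proof.
move=> Jt Et bt; have bE : (b * E v) *: t = b *: t by rewrite -scalerA Et.
have [|Jb|[b' /Jt Jb]] := @E_local v (b * E v); first by rewrite -mulrA E_idem.
  by case: bt; rewrite -bE Jt.
exists b'; apply/eqP; rewrite -bE scalerA -{2}Et eq_sym -subr_eq0 -scalerBl.
exact/eqP.
Qed.

(** The annihilator of [t] in [B E_v] is exactly [J E_v]: an element outside [J] has a multiple
    congruent to [E v] modulo [J] and cannot kill [t]. *)
Lemma pd_le_simple (N : lmodType B) (t : N) v : (forall j, J j -> j *: t = 0) ->
  E v *: t = t -> t <> 0 -> pd_le d.+1 (cyc t).
Proof.
move=> Jt Et t0.
have [|||i [p [ses _]]] := cyc_short_exact (f := submod_incl (rad_submod v)) Et (E_idem v).
- exact: submod_incl_inj.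
- move=> b bE; split=> [bt|[y <-]]; last by apply: Jt; have [] := submodP y.
  have Jb : J b.
    have [//|[b' /Jt]] := E_local bE.
    by rewrite scalerBl Et -scalerA bt scaler0 subr0 => /t0.
  have h : J b /\ b * E v = b by [].
  by exists (Submod (rad_submod v) h).
- by move=> y; have [] := submodP y.
exists (Lid (E v)), (submod (rad_submod v)), i, p; split=> //.
exact: projective_cyc.
Qed.

Section Layer.
Variables (N : lmodType B) (JN : forall j (x : N), J j -> j *: x = 0).

Definition homog (t : N) : Prop := t <> 0 /\ exists v, E v *: t = t.

(** The sum of the cyclic modules [B t] is direct; [m] selects one element in each of them. *)
Definition indep (S : set N) : Prop := (forall t, S t -> homog t) /\
  forall s : seq N, uniq s -> (forall t, t \in s -> S t) ->
  forall m : N -> N, (forall t, t \in s -> exists b, m t = b *: t) ->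
  \sum_(t <- s) m t = 0 -> forall t, t \in s -> m t = 0.

(** A finite list in the union of a chain lies in one member. The empty list is set apart because
    the chain itself may be empty. *)
Lemma chain_finite (F : set (set N)) (s : seq N) :
  total_on F subset -> (forall t, t \in s -> exists2 S, F S & S t) ->
  s = [::] \/ exists2 S, F S & forall t, t \in s -> S t.
Proof.
move=> tot; elim: s => [|a s IH] sP; first by left.
right; have [S FS Sa] := sP a (mem_head _ _).
case: IH => [t ts|s0|[S' FS' S's]]; first by apply: sP; rewrite inE ts orbT.
  by exists S => // t; rewrite s0 inE => /eqP ->.
have [SS'|S'S] := tot _ _ FS FS'.
  by exists S' => // t; rewrite inE => /orP[/eqP ->|/S's //]; apply: SS'.
by exists S => // t; rewrite inE => /orP[/eqP -> //|/S's]; apply: S'S.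
Qed.

Lemma max_indep : exists S, indep S /\ forall S', (S `<` S')%classic -> ~ indep S'.
Proof.
apply: Zorn_bigcup => F FP tot; split=> [t [S FS St]|s us sP m mP m0 t ts].
  by have [h _] := FP _ FS; apply: h.
have [t' /sP [S FS St]|s0|[S FS Ss]] := @chain_finite F s tot; first by exists S.
  by rewrite s0 in ts.
by have [_ h] := FP _ FS; apply: (h s).
Qed.

(** A maximal independent set of homogeneous elements spans [N], which is therefore a direct sum of
    simple modules [B t]. *)
Lemma pd_le_layer : pd_le d.+1 N.
Proof.
have [S [[S_homog S_indep] S_max]] := max_indep.
pose T : eqType := {t : N | `[< S t >]}.
have TP (t : T) : S (val t) by case: t => t /= /asboolP.
have mem_T t : S t -> exists u : T, val u = t.
  by move=> St; exists (exist _ t (asboolT St)).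
pose phi (t : T) : {linear cyc (val t) -> N} := submod_incl _.
pose c := mklin (copair_linear phi).
pose W x := exists f, x = c f.
have [W0 WD] : is_submod W := range_submod c.
have W_cyc t b : S t -> W (b *: t).
  move=> /mem_T [u <-]; have [x xE] := cyc_mem (val u) b.
  exists (delta (M := fun t : T => cyc (val t)) x).
  by rewrite -xE [RHS]copair_delta.
have W_scale b x : W x -> W (b *: x).
  by move=> Wx; rewrite -[_ *: _]addr0; apply: WD.
(* If a homogeneous [t] were outside the span [W], adding it to [S] would keep independence: a
   relation involving a nonzero multiple of [t] would put that multiple in [W], and then [t] itself
   by [local_inv]. *)
have W_homog t : homog t -> W t.
  move=> ht; have [//|WNt] := pselect (W t).
  have NSt : ~ S t by move=> St; apply: WNt; rewrite -[t]scale1r; exact: W_cyc.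
  have sub : (S `<` (fun x => S x \/ x = t))%classic.
    split=> [x Sx|]; first by left.
    by move=> /(_ t) h; apply/NSt/h; right.
  case: (S_max _ sub); split=> [x [/S_homog //|-> //]|s us sP m mP m0].
  have [ts|tNs] := boolP (t \in s); last first.
    apply: (S_indep s) => // x xs; case: (sP _ xs) => // xt.
    by rewrite -xt xs in tNs.
  have remP x : x \in rem t s -> S x /\ x \in s.
    rewrite mem_rem_uniq // inE => /andP[/= /eqP xt xs].
    by case: (sP _ xs).
  have m0' : m t + \sum_(x <- rem t s) m x = 0.
    by rewrite -[RHS]m0 (perm_big _ (perm_to_rem ts)) big_cons.
  have mt : m t = 0.
    have [//|mt] := pselect (m t = 0).
    have Wm : W (m t).
      have -> : m t = (-1) *: (\sum_(x <- rem t s) m x) + 0.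
        by rewrite addr0 scaleN1r; apply/eqP; rewrite -addr_eq0 m0'.
      apply: (WD) => //; rewrite big_seq; apply: big_ind => //.
        by move=> x y Wx Wy; rewrite -[x]scale1r; apply: WD.
      by move=> x /remP [Sx xs]; have [b ->] := mP _ xs; apply: W_cyc.
    have [b bE] := mP _ ts; have [_ [v Et]] := ht.
    have [|b' b'E] := @local_inv N t v b (fun j => @JN j t) Et; first by rewrite -bE.
    by case: WNt; rewrite -b'E -bE; apply: W_scale.
  move=> x xs; have [->//|xt] := eqVneq x t.
  apply: (S_indep (rem t s)); first exact: rem_uniq.
  - by move=> y /remP [].
  - by move=> y /remP [_ /mP].
  - by rewrite -[LHS]add0r -{1}mt m0'.
  - by rewrite mem_rem_uniq // inE xt.
apply: (pd_le_internal (phi := phi)).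
- move=> f f0; apply: dsum_ext => t; rewrite linear0; apply: val_inj.
  have [ts|/suppP -> //] := boolP (t \in supp f).
  pose m x : N := if insub x is Some u then val (coord u f) else 0.
  have mE u : m (val u) = val (coord u f) by rewrite /m valK.
  rewrite -mE; apply: (S_indep (map val (supp f))).
  + by rewrite map_inj_uniq ?undup_uniq //; exact: val_inj.
  + by move=> _ /mapP [u _ ->].
  + by move=> _ /mapP [u _ ->]; rewrite mE; exact: cycP.
  + by rewrite big_map -[RHS]f0 /copair; apply: eq_bigr => u _; rewrite mE.
  + exact: map_f.
(* Every [x] is the sum of its components [E v *: x], each zero or homogeneous. *)
- move=> x; suff [f fE] : W x by exists f; rewrite [RHS]fE.
  rewrite -[x]scale1r -E_sum scaler_suml; apply: big_ind => //.
    by move=> y z Wy Wz; rewrite -[y]scale1r; apply: WD.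
  move=> v _; have [->//|Ex] := pselect (E v *: x = 0).
  by apply: W_homog; split=> //; exists v; rewrite scalerA E_idem.
- move=> t; have [t0 [v Et]] := S_homog _ (TP t).
  by apply: pd_le_simple Et t0 => j; apply: JN.
Qed.

End Layer.

(** Induction on the length of the radical filtration: [M / J M] is killed by [J], and [J M] is
    killed by products one factor shorter. *)
Lemma pd_le_filtered k (M : lmodType B) :
  (forall s : seq B, size s = k -> (forall b, b \in s -> J b) ->
     forall x : M, (\prod_(b <- s) b) *: x = 0) -> pd_le d.+1 M.
Proof.
case: J_ideal => J0 JD JM.
have JMl a b : J b -> J (a * b) by move=> Jb; rewrite -[a * b]mulr1; apply: JM.
elim: k M => [|k IH] M MP.
  apply: (@pd_le_leq _ 0) => //; apply: projective0 => x.
  by have := MP [::] erefl => /(_ _ x); rewrite big_nil scale1r; apply.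
pose JMod (x : M) := forall S, is_submod S -> (forall j y, J j -> S (j *: y)) -> S x.
have JMod_sub : is_submod JMod.
  split=> [S [S0 _] //|a x y Jx Jy S hS SJ].
  by have [_ SD] := hS; apply: SD; [apply: Jx|apply: Jy].
apply: (pd_le_horseshoe (quotm_short_exact JMod_sub)).
  apply: IH => s sk sJ x; apply: val_inj.
  (* Quantifying over all [a] makes this a submodule; the plain annihilation condition need not be
     stable under scalars. *)
  pose Ann (y : M) := forall a, (\prod_(b <- s) b) *: (a *: y) = 0.
  rewrite -[LHS]/((\prod_(b <- s) b) *: val x) -[val x]scale1r.
  apply: (submodP x Ann).
    split=> [a|a y z Ay Az c]; first by rewrite !scaler0.
    by rewrite !scalerDr [c *: (a *: y)]scalerA Ay Az addr0.
  move=> j y Jj a; rewrite [a *: _]scalerA scalerA -big_rcons.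
  apply: MP; first by rewrite size_rcons sk.
  by move=> b; rewrite mem_rcons inE => /orP[/eqP ->|/sJ //]; exact: JMl.
apply: pd_le_layer => j x Jj; have [y <-] := quotm_proj_surj x.
rewrite -[_ *: _](linearZ_LR (mklin (@quotm_proj_linear _ _ _ JMod_sub))) /=.
have [_ _ ex] := quotm_short_exact JMod_sub.
apply/ex; have h : JMod (j *: y) by move=> S _; apply.
by exists (Submod JMod_sub h).
Qed.

End Semisimple.
Theorem gldim_finite_criterion :
  gldim_finite B <-> forall x, exists k, iter k (obind sigma) (Some x) = None.
Proof.
rewrite gldim_finiteE; split=> [[n pdn] x|sigma_nil].
  have [//|h] := pselect (exists k, iter k (obind sigma) (Some x) = None).
  have [] := @gldim_infinite x n _ (pdn _).
  by move=> k hk; apply: h; exists k.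
have [n nP] := pd_le_rad sigma_nil.
have [m mP] := J_nil; exists n.+1 => M.
apply: (pd_le_filtered nP (k := m)) => s sm sJ x.
by rewrite mP // scale0r.
Qed.

End Criterion.

(** * Stripping arrows in the path algebra *)

Section PathCalculus.
Variables (K : fieldType) (Q : quiver).
Local Notation KQ := (path_alg K Q).
Implicit Types (f h : KQ) (p q : qpath Q) (a b : arr Q) (v w : vert Q).

Definition pa_vert v : KQ := pa_path K (triv_path v).

Lemma pa_ind (P : KQ -> Prop) : P 0 ->
  (forall c f h, P f -> P h -> P (c *: f + h)) -> (forall p, P (pa_path K p)) ->
  forall f, P f.
Proof.
move=> P0 PD Pp f; rewrite -[f]lin_ext_id /lin_ext; apply: big_ind => //.
  by move=> x y Px Py; rewrite -[x]scale1r; apply: PD.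
by move=> p _; rewrite -[_ *: _]addr0; apply: PD => //; exact: Pp.
Qed.

Lemma pa_scalerAl c f h : (c *: f) * h = c *: (f * h).
Proof. exact: (linearZ_LR (lin_ext (fun p => lin_ext (pa_mulp K p) h))). Qed.

Lemma pa_scalerAr c f h : f * (c *: h) = c *: (f * h).
Proof.
rewrite -[LHS]/(pa_mul f (c *: h)) -[f * h]/(pa_mul f h) /pa_mul {1}/lin_ext.
rewrite {3}/lin_ext scaler_sumr; apply: eq_bigr => p _.
by rewrite linearZ !scalerA [_ * c]mulrC.
Qed.

Lemma pa_pathM p q : pa_path K p * pa_path K q = pa_mulp K p q.
Proof. by rewrite [LHS]lin_extU lin_extU. Qed.

Lemma pa_vertM v w : pa_vert v * pa_vert w = if v == w then pa_vert v else 0.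
Proof. by rewrite pa_pathM /pa_mulp pcomp_trivl /ptgt /= eq_sym; case: eqP => [->|]. Qed.

Lemma pa_path_vert p v : pa_path K p * pa_vert v = if psrc p == v then pa_path K p else 0.
Proof. by rewrite pa_pathM /pa_mulp pcomp_trivr eq_sym; case: eqP. Qed.

Lemma pa_vert_path p v : pa_vert v * pa_path K p = if ptgt p == v then pa_path K p else 0.
Proof. by rewrite pa_pathM /pa_mulp pcomp_trivl eq_sym; case: eqP. Qed.

Lemma pa_arr_vert a v : pa_arr K a * pa_vert v = if src a == v then pa_arr K a else 0.
Proof. exact: pa_path_vert. Qed.

Lemma pa_vert_arr a v : pa_vert v * pa_arr K a = if tgt a == v then pa_arr K a else 0.
Proof. exact: pa_vert_path. Qed.

Lemma pa_vert_sum : \sum_v pa_vert v = 1. Proof. by []. Qed.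

(** Paths are analysed at the right end of their word, the arrow travelled first, since that is
    where stripping acts. *)
Variant snoc_spec p : Prop :=
| SnocTriv v of p = triv_path v
| SnocArr r b of pcomp r (arr_path b) = Some p.

Lemma snocP p : snoc_spec p.
Proof.
case: p => -[v w] /= hw; case/lastP: w hw => [|w b] hw.
  by apply: (@SnocTriv _ v); apply: val_inj.
have /andP[hw' /= /andP[/eqP tb _]] : is_path v w && is_path (last v (map (@src Q) w)) [:: b].
  by rewrite -is_path_cat cats1.
pose r : qpath Q := exist _ (v, w) hw'; apply: (@SnocArr _ r b).
have [|s -> vs] := @pcompP _ r (arr_path b); first by rewrite [RHS]tb.
by congr Some; apply: val_inj; rewrite vs /= cats1.
Qed.

Lemma pcomp_parrs p q r : pcomp p q = Some r -> parrs r = parrs p ++ parrs q.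
Proof.
rewrite /pcomp; case: eqP => // e; case: insubP => // u _ vu [<-].
by rewrite /parrs vu.
Qed.

Lemma snoc_src r b p : pcomp r (arr_path b) = Some p -> psrc p = src b.
Proof. by move=> /pcomp_src. Qed.

Lemma pa_lin_ext (W : lmodType K) (F G : KQ -> W) :
  (forall c f1 f2, F (c *: f1 + f2) = c *: F f1 + F f2) ->
  (forall c f1 f2, G (c *: f1 + f2) = c *: G f1 + G f2) ->
  (forall p, F (pa_path K p) = G (pa_path K p)) -> forall f, F f = G f.
Proof.
move=> Fl Gl FG.
have lin0 (H : KQ -> W) : (forall c h1 h2, H (c *: h1 + h2) = c *: H h1 + H h2) -> H 0 = 0.
  by move=> H_lin; rewrite -[X in H X](addNr 0) -scaleN1r H_lin scaleN1r addNr.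
move=> f; elim/pa_ind: f => [|c f1 f2 E1 E2|p]; last exact: FG.
  by rewrite !lin0.
by rewrite Fl Gl E1 E2.
Qed.

Lemma bilin_ext (W : lmodType K) (F G : KQ -> KQ -> W) :
  (forall h c f1 f2, F (c *: f1 + f2) h = c *: F f1 h + F f2 h) ->
  (forall f c h1 h2, F f (c *: h1 + h2) = c *: F f h1 + F f h2) ->
  (forall h c f1 f2, G (c *: f1 + f2) h = c *: G f1 h + G f2 h) ->
  (forall f c h1 h2, G f (c *: h1 + h2) = c *: G f h1 + G f h2) ->
  (forall p q, F (pa_path K p) (pa_path K q) = G (pa_path K p) (pa_path K q)) ->
  forall f h, F f h = G f h.
Proof.
move=> Fl Fr Gl Gr FG f h; apply: (pa_lin_ext (Fr f) (Gr f)) => q.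
exact: (pa_lin_ext (Fl (pa_path K q)) (Gl (pa_path K q)) (FG^~ q)).
Qed.

(** The augmentation at [v]; by [chiM] it is multiplicative. *)
Definition chi v f : K := (f : {malg K[qpath Q]})@_(triv_path v).

Lemma chiD v f h : chi v (f + h) = chi v f + chi v h.
Proof. exact: mcoeffD. Qed.
Lemma chiZ v c f : chi v (c *: f) = c * chi v f.
Proof. exact: mcoeffZ. Qed.
Lemma chi_lin v c f h : chi v (c *: f + h) = c * chi v f + chi v h.
Proof. by rewrite chiD chiZ. Qed.
Lemma chi0 v : chi v 0 = 0.
Proof. exact: mcoeff0. Qed.
Lemma chi_path v p : chi v (pa_path K p) = (p == triv_path v)%:R.
Proof. exact: mcoeffU. Qed.
Lemma chi_vert v w : chi v (pa_vert w) = (v == w)%:R.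
Proof.
rewrite chi_path (_ : (_ == _) = (v == w)) // -val_eqE /= xpair_eqE andbT.
exact: eq_sym.
Qed.
Lemma chi_snoc v r b p : pcomp r (arr_path b) = Some p -> chi v (pa_path K p) = 0.
Proof.
move=> /pcomp_parrs rb; rewrite chi_path; case: eqP => // e.
by move: rb; rewrite e /=; case: (parrs r).
Qed.
Lemma chi_arr v b : chi v (pa_arr K b) = 0.
Proof. by rewrite chi_path; case: eqP => // /(congr1 (@parrs Q)). Qed.

#[local] Opaque chi.

(** A product of two paths is the trivial path at [v] exactly when both factors are. *)
Lemma chiM v f h : chi v (f * h) = chi v f * chi v h.
Proof.
move: f h; apply: (@bilin_ext K^o) => [h c f1 f2|f c h1 h2|h c f1 f2|f c h1 h2|p q].
- by rewrite mulrDl pa_scalerAl chi_lin.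
- by rewrite mulrDr pa_scalerAr chi_lin.
- by rewrite chi_lin mulrDl -mulrA.
- by rewrite chi_lin mulrDr mulrCA.
rewrite pa_pathM /pa_mulp; case: (snocP q) => [w ->|r b rb]; last first.
  rewrite [X in _ = _ * X](chi_snoc v rb) mulr0; case e: (pcomp p q) => [s|] /=; last exact: chi0.
  have := pcompA p r (arr_path b); rewrite rb /= e.
  by case: (pcomp p r) => //= t /esym te; apply: chi_snoc te.
rewrite pcomp_trivr [X in _ = _ * X]chi_vert [X in _ = X * _]chi_path.
have [->|pw] := eqVneq w (psrc p) => /=.
  rewrite chi_path; have [->|_] := eqVneq p (triv_path v); last by rewrite mul0r.
  by rewrite eqxx mulr1.
rewrite chi0; have [pv|_] := eqVneq p (triv_path v); last by rewrite mul0r.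
by have [vw|_] := eqVneq v w; rewrite ?mulr0 //; case/eqP: pw; rewrite pv vw.
Qed.

Definition stripp a p : KQ :=
  if (parrs p != [::]) && (last a (parrs p) == a) then
    oapp (@pa_path K Q) 0 (insub (ptgt p, take (size (parrs p)).-1 (parrs p)))
  else 0.

Lemma stripp_triv a v : stripp a (triv_path v) = 0.
Proof. by []. Qed.

Lemma stripp_snoc a b p r : pcomp r (arr_path b) = Some p ->
  stripp a p = if b == a then pa_path K r else 0.
Proof.
move=> rb; rewrite /stripp (pcomp_tgt rb) (pcomp_parrs rb).
rewrite cats1 last_rcons -size_eq0 size_rcons /=.
case: eqP => // _; rewrite -cats1 take_size_cat //.
have -> : (ptgt r, parrs r) = val r by rewrite /ptgt /parrs; case: (val r).
by rewrite valK.
Qed.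

Lemma stripp_src a p : psrc p != src a -> stripp a p = 0.
Proof.
case: (snocP p) => [v ->|r b rb] //; rewrite (stripp_snoc _ rb) (snoc_src rb).
by have [->|//] := eqVneq b a; rewrite eqxx.
Qed.

(* [strip a] sends a path [w a] to [w], and every path not beginning with [a]
   to [0]. *)
Definition strip a : KQ -> KQ := lin_ext (stripp a).

Lemma strip_linear a : linear (strip a).
Proof. exact: lin_ext_linear. Qed.

Lemma stripD a f h : strip a (f + h) = strip a f + strip a h.
Proof. by rewrite -[f]scale1r strip_linear !scale1r. Qed.
Lemma strip0 a : strip a 0 = 0.
Proof. exact: linear0. Qed.
Lemma stripZ a c f : strip a (c *: f) = c *: strip a f.
Proof. by rewrite -[c *: f]addr0 strip_linear strip0 addr0. Qed.
Lemma strip_lin a c f h : strip a (c *: f + h) = c *: strip a f + strip a h.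
Proof. exact: strip_linear. Qed.
Lemma strip_path a p : strip a (pa_path K p) = stripp a p.
Proof. exact: lin_extU. Qed.

#[local] Opaque strip.

Lemma strip_arr a b : strip a (pa_arr K b) = if b == a then pa_vert (tgt b) else 0.
Proof.
rewrite strip_path (@stripp_snoc a b _ (triv_path (tgt b))) //.
by rewrite pcomp_trivl eqxx.
Qed.

Lemma strip_vert a v : strip a (pa_vert v) = 0.
Proof. by rewrite strip_path. Qed.

(** The rightmost arrow of [p q] belongs to [q] unless [q] is trivial, when it belongs to [p]; in
    that case [q] must be the trivial path at [src a] for [a] to be stripped. *)
Lemma strip_mul a f h : strip a (f * h) = f * strip a h + chi (src a) h *: strip a f.
Proof.
move: f h; apply: (@bilin_ext KQ) => [h c f1 f2|f c h1 h2|h c f1 f2|f c h1 h2|p q].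
- by rewrite mulrDl pa_scalerAl strip_lin.
- by rewrite mulrDr pa_scalerAr strip_lin.
- by rewrite strip_lin mulrDl pa_scalerAl !scalerDr !scalerA [c * _]mulrC addrACA.
- by rewrite strip_lin chi_lin mulrDr pa_scalerAr scalerDl scalerDr scalerA addrACA.
rewrite pa_pathM [X in _ = _ * X + _]strip_path [X in _ = _ + _ *: X]strip_path.
rewrite /pa_mulp; case: (snocP q) => [w ->|r b rb]; last first.
  rewrite [X in X *: _](chi_snoc _ rb) scale0r addr0 (stripp_snoc a rb).
  have := pcompA p r (arr_path b); rewrite rb /= => ->.
  have [ba|nba] := eqVneq b a; last first.
    rewrite mulr0; case: (pcomp p r) => [s|] /=; last exact: strip0.
    case e: (pcomp s _) => [t|] /=; last exact: strip0.
    by rewrite strip_path (stripp_snoc a e) (negPf nba).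
  rewrite pa_pathM /pa_mulp; case prs: (pcomp p r) => [s|] /=; last exact: strip0.
  have := pcompA p r (arr_path b); rewrite prs rb /=.
  have [|t st _] := @pcompP _ s (arr_path b).
    rewrite (pcomp_src prs); apply/eqP; move: rb; rewrite /pcomp.
    by case: eqP.
  by rewrite st /= strip_path (stripp_snoc a st) ba eqxx.
rewrite stripp_triv mulr0 add0r pcomp_trivr chi_vert.
have [->|pw] := eqVneq w (psrc p).
  rewrite /= strip_path; have [_|] := eqVneq (src a) (psrc p); first by rewrite scale1r.
  by rewrite scale0r eq_sym => /stripp_src.
rewrite /= strip0; have [aw|_] := eqVneq (src a) w; last by rewrite scale0r.
by rewrite scale1r stripp_src // aw eq_sym.
Qed.

Lemma pa_decomp f :
  f = \sum_v chi v f *: pa_vert v + \sum_a strip a f * pa_arr K a.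
Proof.
have sum_lin (I : finType) (H : I -> KQ -> KQ) :
    (forall i c f1 f2, H i (c *: f1 + f2) = c *: H i f1 + H i f2) ->
    forall c f1 f2, \sum_i H i (c *: f1 + f2) = c *: (\sum_i H i f1) + \sum_i H i f2.
  move=> Hl c f1 f2; rewrite scaler_sumr -big_split.
  by apply: eq_bigr => i _; exact: Hl.
apply: (pa_lin_ext (F := id)
  (G := fun h => \sum_v chi v h *: pa_vert v + \sum_a strip a h * pa_arr K a)) => // [c f1 f2|p].
  have comb (x1 x2 y1 y2 : KQ) : c *: x1 + x2 + (c *: y1 + y2) = c *: (x1 + y1) + (x2 + y2).
    by rewrite scalerDr addrACA.
  apply: etrans (congr2 +%R (sum_lin _ (fun v h => chi v h *: pa_vert v) _ c f1 f2)
    (sum_lin _ (fun a h => strip a h * pa_arr K a) _ c f1 f2)) (comb _ _ _ _).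
    by move=> v c' h1 h2; rewrite chi_lin scalerDl scalerA.
  by move=> a c' h1 h2; rewrite strip_lin mulrDl pa_scalerAl.
case: (snocP p) => [v ->|r b rb].
  rewrite [X in _ + X]big1 => [|a _]; last by rewrite strip_vert mul0r.
  rewrite addr0 (bigD1 v) //= chi_vert eqxx scale1r big1 ?addr0 // => w wv.
  by rewrite chi_vert (negPf wv) scale0r.
rewrite big1 => [|v _]; last by rewrite (chi_snoc _ rb) scale0r.
rewrite add0r (bigD1 b) //= strip_path (stripp_snoc _ rb) eqxx big1 ?addr0 => [|a ab].
  by rewrite pa_pathM /pa_mulp rb.
by rewrite strip_path (stripp_snoc _ rb) eq_sym (negPf ab) mul0r.
Qed.

End PathCalculus.

(** * Quadratic relations between labelled sums of arrows *)

Section QuotientMorphism.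
Variables (P : pzRingType) (R : P -> Prop).
Local Open Scope quotient_scope.

Definition qpi (f : P) : quot_ring R := \pi_(quot_ring R) f.

Lemma qpi_surj b : exists f, b = qpi f.
Proof. by exists (repr b); rewrite /qpi reprK. Qed.
Lemma qpiM f h : qpi (f * h) = qpi f * qpi h.
Proof. by rewrite /qpi -quot_mulE. Qed.
Lemma qpiD f h : qpi (f + h) = qpi f + qpi h.
Proof. exact: quot_piD. Qed.
Lemma qpi1 : qpi 1 = 1. Proof. by []. Qed.
Lemma qpiB_eq0 f h : qpi f = qpi h <-> ideal_gen R (f - h).
Proof.
split=> [/eqP|/ideal_predP fh]; first by rewrite quot_piE => /ideal_predP.
by apply/eqP; rewrite quot_piE.
Qed.
Lemma qpi0 : qpi 0 = 0.
Proof. by apply: (addrI (qpi 0)); rewrite -qpiD !addr0. Qed.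
Lemma qpi_eq0 f : qpi f = 0 <-> ideal_gen R f.
Proof. by rewrite -qpi0 qpiB_eq0 subr0. Qed.
Lemma qpiN f : qpi (- f) = - qpi f.
Proof. by apply: (addrI (qpi f)); rewrite -qpiD !subrr qpi0. Qed.
Lemma qpi_sum (I : Type) (r : seq I) (S : pred I) (F : I -> P) :
  qpi (\sum_(i <- r | S i) F i) = \sum_(i <- r | S i) qpi (F i).
Proof. exact: (big_morph _ qpiD qpi0). Qed.
Lemma qpi_prod (I : Type) (r : seq I) (S : pred I) (F : I -> P) :
  qpi (\prod_(i <- r | S i) F i) = \prod_(i <- r | S i) qpi (F i).
Proof. exact: (big_morph _ qpiM qpi1). Qed.
End QuotientMorphism.

(** In a pair [(y, x)] the arrow [x] is travelled first. When each [x] has at most one such [y], the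
    pick is canonical and its iterates follow the only chain of relations from [x]. *)
Definition rel_pred (X : finType) (I : {set X * X}) (x : X) : option X :=
  [pick y | (y, x) \in I].

(* Everything the argument uses about the path algebra; reasoning over an abstract
   ring keeps unification from unfolding the convolution product. *)
Record strip_ring (K : fieldType) (P : pzRingType) (V A : finType)
    (src tgt : A -> V) (E : V -> P) (ar : A -> P) (scal : K -> P)
    (chi : V -> P -> K) (strip : A -> P -> P) : Prop := StripRing {
  sr_scal_comm : forall c f, scal c * f = f * scal c;
  sr_scalM : forall c d, scal (c * d) = scal c * scal d;
  sr_scal0 : scal 0 = 0;
  sr_scal1 : scal 1 = 1;
  sr_chi0 : forall v, chi v 0 = 0;
  sr_chiD : forall v f h, chi v (f + h) = chi v f + chi v h;
  sr_chiM : forall v f h, chi v (f * h) = chi v f * chi v h;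
  sr_chi_scal : forall v c f, chi v (scal c * f) = c * chi v f;
  sr_chi_E : forall v w, chi v (E w) = (v == w)%:R;
  sr_chi_ar : forall v a, chi v (ar a) = 0;
  sr_strip0 : forall a, strip a 0 = 0;
  sr_stripD : forall a f h, strip a (f + h) = strip a f + strip a h;
  sr_strip_scal : forall a c f, strip a (scal c * f) = scal c * strip a f;
  sr_strip_mul : forall a f h,
    strip a (f * h) = f * strip a h + scal (chi (src a) h) * strip a f;
  sr_strip_E : forall a v, strip a (E v) = 0;
  sr_strip_ar : forall a b, strip a (ar b) = if b == a then E (tgt b) else 0;
  sr_decomp : forall f,
    f = \sum_v scal (chi v f) * E v + \sum_a strip a f * ar a;
  sr_E_mul : forall v w, E v * E w = if v == w then E v else 0;
  sr_E_sum : \sum_v E v = 1;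
  sr_ar_E : forall a v, ar a * E v = if src a == v then ar a else 0;
  sr_E_ar : forall a v, E v * ar a = if tgt a == v then ar a else 0
}.

Section StripRing.
Variables (K : fieldType) (P : pzRingType) (V A : finType).
Variables (src tgt : A -> V) (E : V -> P) (ar : A -> P) (scal : K -> P).
Variables (chi : V -> P -> K) (strip : A -> P -> P).
Hypothesis laws : strip_ring src tgt E ar scal chi strip.
Let scal_comm := sr_scal_comm laws.
Let scalM := sr_scalM laws.
Let scal0 := sr_scal0 laws.
Let scal1 := sr_scal1 laws.
Let chi0 := sr_chi0 laws.
Let chiD := sr_chiD laws.
Let chiM := sr_chiM laws.
Let chi_scal := sr_chi_scal laws.
Let chi_E := sr_chi_E laws.
Let chi_ar := sr_chi_ar laws.
Let strip0 := sr_strip0 laws.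
Let stripD := sr_stripD laws.
Let strip_scal := sr_strip_scal laws.
Let strip_mul := sr_strip_mul laws.
Let strip_E := sr_strip_E laws.
Let strip_ar := sr_strip_ar laws.
Let decomp := sr_decomp laws.
Let E_mul := sr_E_mul laws.
Let E_sum := sr_E_sum laws.
Let ar_E := sr_ar_E laws.
Let E_ar := sr_E_ar laws.

Lemma chi_sum v (T : Type) (r : seq T) (S : pred T) (F : T -> P) :
  chi v (\sum_(i <- r | S i) F i) = \sum_(i <- r | S i) chi v (F i).
Proof. exact: (big_morph _ (chiD v) (chi0 v)). Qed.

Lemma chiN v f : chi v (- f) = - chi v f.
Proof. by apply: (addrI (chi v f)); rewrite -chiD !subrr chi0. Qed.

Lemma strip_sum a (T : Type) (r : seq T) (S : pred T) (F : T -> P) :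
  strip a (\sum_(i <- r | S i) F i) = \sum_(i <- r | S i) strip a (F i).
Proof. exact: (big_morph _ (stripD a) (strip0 a)). Qed.

Lemma ar_mul0 a b : src a != tgt b -> ar a * ar b = 0.
Proof.
move=> ab; have := ar_E a (src a); rewrite eqxx => <-.
by rewrite -mulrA E_ar eq_sym (negPf ab) mulr0.
Qed.

(** * Words avoiding monomial relations do not vanish in the quotient *)

Section FreeWords.
Variable I : {set A * A}.

Definition free_rel (a b : A) : bool := (src a == tgt b) && ((a, b) \notin I).

Definition strips (u : seq A) (z : P) : P := foldr strip z u.

Lemma strips0 u : strips u 0 = 0.
Proof. by elim: u => //= a u ->; exact: strip0. Qed.

(** In a path algebra [chi v (strips u z)] is the coefficient in [z] of the path with word [u] and
    target [v], so the condition says that no relation-free path occurs in [z]. *)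
Definition free_zero (z : P) : Prop :=
  forall u v, sorted free_rel u -> chi v (strips u z) = 0.

Lemma strips_mull z b u : free_zero z -> sorted free_rel u ->
  strips u (b * z) = b * strips u z.
Proof.
move=> zP; elim: u => //= a u IH ua; have su := path_sorted ua.
by rewrite IH // strip_mul zP // scal0 mul0r addr0.
Qed.

Lemma free_zero_mulr z b : free_zero z -> free_zero (z * b).
Proof.
move=> zP u v su.
(* Iterating [strip_mul] leaves, besides the main term, only prefixes of [u] stripped from [z], and
   prefixes of free words are free. *)
have [c ->] : exists c : nat -> K, strips u (z * b) =
    z * strips u b + \sum_(j < size u) scal (c j) * strips (take j.+1 u) z.
  elim: u {su} => [|a u [c IH]] /=; first by exists (fun=> 0); rewrite big_ord0 addr0.
  exists (fun j => if j is j'.+1 then c j' else chi (src a) (strips u b)).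
  rewrite IH stripD strip_mul -addrA; congr (_ + _).
  rewrite big_ord_recl take0 /=; congr (_ + _).
  by rewrite strip_sum; apply: eq_bigr => j _; rewrite strip_scal.
rewrite chiD chiM chi_sum big1 ?addr0.
  by have := zP [::] v erefl => /= ->; rewrite mul0r.
by move=> j _; rewrite chi_scal zP ?mulr0 // take_sorted.
Qed.

Lemma free_zero_gen a b : (a, b) \in I -> free_zero (ar a * ar b).
Proof.
move=> ab u v; case/lastP: u => [|u c]; first by rewrite /= chiM chi_ar mul0r.
rewrite /strips -cats1 foldr_cat /= strip_mul chi_ar scal0 mul0r addr0 strip_ar.
case: eqP => [<-|_]; last by rewrite mulr0 -/(strips u 0) strips0 chi0.
rewrite ar_E; case: eqP => _; last by rewrite -/(strips u 0) strips0 chi0.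
case/lastP: u => [|u d]; first by rewrite /= chi_ar.
rewrite -cats1 foldr_cat /= strip_ar; case: eqP => [<-|_]; last first.
  by rewrite -/(strips u 0) strips0 chi0.
case/lastP: u => [|u d']; last first.
  by rewrite -cats1 foldr_cat /= strip_E -/(strips u 0) strips0 chi0.
by rewrite /= /free_rel ab andbF.
Qed.

(** The elements satisfying [free_zero] form a two-sided ideal containing the generators. *)
Lemma ideal_gen_free z (S : P -> Prop) :
  (forall x, S x -> exists a b, (a, b) \in I /\ x = ar a * ar b) ->
  ideal_gen S z -> free_zero z.
Proof.
move=> SP; apply; first split.
- by move=> u v _; rewrite strips0 chi0.
- move=> x y xP yP u v su.
  suff -> : strips u (x + y) = strips u x + strips u y by rewrite chiD xP // yP // addr0.
  by elim: u {su} => //= a u ->; exact: stripD.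
- move=> a b x xP; apply: free_zero_mulr => u v su.
  by rewrite strips_mull // chiM xP // mulr0.
by move=> x /SP [a [b [ab ->]]]; exact: free_zero_gen.
Qed.

Lemma strips_word u : sorted free_rel u -> u != [::] ->
  exists v, chi v (strips u (\prod_(a <- u) ar a)) = 1.
Proof.
elim/last_ind: u => // u a IH su _; rewrite /strips -cats1 foldr_cat big_cat big_seq1 /=.
rewrite strip_mul chi_ar scal0 mul0r addr0 strip_ar eqxx.
case/lastP: u IH su => [|u b] IH su.
  by exists (tgt a); rewrite /= big_nil mul1r chi_E eqxx.
have -> : \prod_(a <- rcons u b) ar a * E (tgt a) = \prod_(a <- rcons u b) ar a.
  rewrite -cats1 big_cat big_seq1 -mulrA ar_E.
  move: su; rewrite -!cats1 -catA sorted_cat_cons /= => /andP[_ /andP[/andP[-> _] _]].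
  by [].
apply: IH; last by rewrite -size_eq0 size_rcons.
by move: su; rewrite -cats1 => /cat_sorted2[].
Qed.

Lemma free_word_notin u (S : P -> Prop) :
  (forall x, S x -> exists a b, (a, b) \in I /\ x = ar a * ar b) ->
  sorted free_rel u -> u != [::] -> ~ ideal_gen S (\prod_(a <- u) ar a).
Proof.
move=> SP su u0 /(ideal_gen_free SP) h; have [v] := strips_word su u0.
by rewrite h // => /eqP; rewrite eq_sym oner_eq0.
Qed.

End FreeWords.

(** * The general construction: relations between signed sums of arrows *)

Section Labelled.
Variable X : finType.
(** A label [x] stands for one arrow from each vertex of [inS x] to each vertex of [inT x]. In the
    monomial case an arrow is its own label and [lam] is 1; in the skewed-gentle case labels are
    arrows of [Q] and [lam] is [sg_sign]. *)
Variables (lab : A -> X) (inS inT : X -> pred V) (lam : V -> K) (I : {set X * X}).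
Variable R : P -> Prop.
Hypothesis lam_sq : forall v, lam v * lam v = 1.
Hypothesis lab_src : forall a, inS (lab a) (src a).
Hypothesis lab_tgt : forall a, inT (lab a) (tgt a).
Hypothesis lab_ex : forall x u w, inS x u -> inT x w ->
  exists a, [/\ lab a = x, src a = u & tgt a = w].
Hypothesis lab_inj : forall a b, lab a = lab b -> src a = src b -> tgt a = tgt b -> a = b.
Hypothesis inS_ex : forall x, exists v, inS x v.
Hypothesis inT_ex : forall x, exists v, inT x v.
Hypothesis I_comp : forall x y, (x, y) \in I -> inS x =1 inT y.
Hypothesis I_uniq : forall x x' y, (x, y) \in I -> (x', y) \in I -> x = x'.

(** With the sign at the source, [bigarr x * bigarr y] carries the sign of the middle vertex that
    the relations require; the sign of the outer source only rescales components. *)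
Definition bigarr (x : X) : P := \sum_(a | lab a == x) scal (lam (src a)) * ar a.

Definition bigrels (z : P) : Prop :=
  exists x y, (x, y) \in I /\ z = bigarr x * bigarr y.

Section Generated.
Hypothesis R_gen : forall z, ideal_gen R z <-> ideal_gen bigrels z.
Hypothesis R_nil : exists m, forall w : seq A, size w = m -> ideal_gen R (\prod_(a <- w) ar a).

Definition bigtgt (x : X) : P := \sum_(w | inT x w) E w.

Lemma sum_if_eq (T : finType) (W : nmodType) (t : T) (S : pred T) (F : T -> W) :
  \sum_(i | S i) (if i == t then F i else 0) = if S t then F t else 0.
Proof.
case: ifP => St; first by rewrite (bigD1 t) //= eqxx big1 ?addr0 // => i /andP[_ /negPf ->].
by rewrite big1 // => i Si; case: eqP => // e; rewrite e St in Si.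
Qed.

Lemma bigtgt_idem x : bigtgt x * bigtgt x = bigtgt x.
Proof.
rewrite mulr_sumr; apply: eq_bigr => w xw; rewrite mulr_suml.
under eq_bigr do rewrite E_mul.
transitivity (\sum_(i | inT x i) if i == w then E i else 0); first by [].
by rewrite sum_if_eq xw.
Qed.

Lemma bigtgt_arr x : bigtgt x * bigarr x = bigarr x.
Proof.
rewrite mulr_sumr; apply: eq_bigr => a /eqP ax.
rewrite mulrA -scal_comm -mulrA; congr (_ * _); rewrite mulr_suml.
under eq_bigr do rewrite E_ar eq_sym.
by rewrite sum_if_eq -ax lab_tgt.
Qed.

Lemma bigarr_E x v : bigarr x * E v =
  \sum_(a | (lab a == x) && (src a == v)) scal (lam v) * ar a.
Proof.
rewrite mulr_suml big_mkcondr; apply: eq_bigr => a _.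
by rewrite -mulrA ar_E; case: eqP => [->|] //; rewrite mulr0.
Qed.

Lemma bigarr_E0 x v : ~~ inS x v -> bigarr x * E v = 0.
Proof.
move=> xv; rewrite bigarr_E big_pred0 // => a; apply: contraNF xv.
by move=> /andP[/eqP <- /eqP <-]; exact: lab_src.
Qed.

Lemma bigarr_tgt x y : (x, y) \in I -> bigarr x * bigtgt y = bigarr x.
Proof.
move=> /I_comp xy; rewrite -[RHS]mulr1 -E_sum /bigtgt !mulr_sumr big_mkcond.
apply: eq_bigr => v _; rewrite -xy; case: ifP => // xv.
by rewrite bigarr_E0 ?xv.
Qed.

Lemma E_bigarr_E a : E (tgt a) * bigarr (lab a) * E (src a) = scal (lam (src a)) * ar a.
Proof.
rewrite -mulrA bigarr_E mulr_sumr (bigD1 a) /= ?eqxx // big1 ?addr0.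
  by rewrite mulrA -scal_comm -mulrA E_ar eqxx.
move=> b /andP[/andP[/eqP ab /eqP sb] /eqP nab].
rewrite mulrA -scal_comm -mulrA E_ar; case: eqP => [tb|_]; last by rewrite mulr0.
by case: nab; apply: lab_inj.
Qed.

Lemma chi_bigarr v x : chi v (bigarr x) = 0.
Proof. by rewrite chi_sum big1 // => a _; rewrite chi_scal chi_ar mulr0. Qed.

Lemma chi_bigtgt x w : inT x w -> chi w (bigtgt x) = 1.
Proof.
move=> xw; rewrite chi_sum; under eq_bigr do rewrite chi_E eq_sym.
transitivity (\sum_(i | inT x i) if i == w then (1 : K) else 0).
  by apply: eq_bigr => i _; case: eqP.
by rewrite sum_if_eq xw.
Qed.

(* The coefficient of [g_x E_v] in the expansion of [f E_v]. *)
Definition dstrip v x f : P :=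
  \sum_(a | (lab a == x) && (src a == v)) scal (lam v) * strip a f.

Lemma dstripD v x f h : dstrip v x (f + h) = dstrip v x f + dstrip v x h.
Proof. by rewrite -big_split; apply: eq_bigr => a _; rewrite stripD mulrDr. Qed.

Lemma dstrip0 v x : dstrip v x 0 = 0.
Proof. by apply: big1 => a _; rewrite strip0 mulr0. Qed.

Lemma dstrip_mul v x f h :
  dstrip v x (f * h) = f * dstrip v x h + scal (chi v h) * dstrip v x f.
Proof.
rewrite /dstrip !mulr_sumr -big_split; apply: eq_bigr => a /andP[_ /eqP av].
rewrite strip_mul av mulrDr; congr (_ + _).
  by rewrite mulrA scal_comm -mulrA.
by rewrite !mulrA -!scalM [lam v * _]mulrC.
Qed.

Lemma dstrip_E v x w : dstrip v x (E w) = 0.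
Proof. by apply: big1 => a _; rewrite strip_E mulr0. Qed.

Lemma dstrip_bigarr v x y : inS x v ->
  dstrip v x (bigarr y) = if x == y then bigtgt x else 0.
Proof.
move=> xv; have stripE a : strip a (bigarr y) =
    if lab a == y then scal (lam (src a)) * E (tgt a) else 0.
  rewrite strip_sum; under eq_bigr do rewrite strip_scal strip_ar (fun_if ( *%R _)) mulr0.
  by rewrite sum_if_eq.
transitivity (\sum_(a | (lab a == x) && (src a == v)) if x == y then E (tgt a) else 0).
  apply: eq_bigr => a /andP[/eqP ax /eqP av]; rewrite stripE ax av.
  by case: eqP => _; rewrite ?mulr0 // mulrA -scalM lam_sq scal1 mul1r.
case: eqP => _; last exact: big1.
rewrite (partition_big tgt (inT x)) => [|a /andP[/eqP <- _]]; last exact: lab_tgt.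
apply: eq_bigr => w xw; have [a [ax av aw]] := lab_ex xv xw.
rewrite (big_pred1 a) ?aw // => b; apply/idP/eqP => [|->].
  by move=> /andP[/andP[/eqP bx /eqP bv] /eqP bw]; apply: lab_inj; congruence.
by rewrite ax av aw !eqxx.
Qed.

Lemma rel_predP x y : rel_pred I x = Some y -> (y, x) \in I.
Proof. by rewrite /rel_pred; case: pickP => // z zx [<-]. Qed.

Lemma rel_pred_eq x y : (y, x) \in I -> rel_pred I x = Some y.
Proof.
rewrite /rel_pred; case: pickP => [z zx yx|/(_ y) /= -> //].
by congr Some; apply: I_uniq zx yx.
Qed.

(** The elements with these properties form a two-sided ideal, by the derivation rule [dstrip_mul].
    On a generator [bigarr y * bigarr x] the map returns [bigarr y * bigtgt x], that is
    [bigarr y]. *)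
Lemma ideal_gen_mem r : ideal_gen R r ->
  forall v x, inS x v -> chi v r = 0 /\
    exists2 t, ideal_gen R t & if rel_pred I x is Some y
      then exists d, dstrip v x r = t + d * bigarr y else dstrip v x r = t.
Proof.
move=> hr v x xv.
have [T0 TD TM] := ideal_genP R.
pose J r := [/\ ideal_gen R r, chi v r = 0 & exists2 t, ideal_gen R t &
  if rel_pred I x is Some y then exists d, dstrip v x r = t + d * bigarr y
  else dstrip v x r = t].
suff [_ r0 rt] : J r by [].
apply: (proj1 (R_gen r) hr); first split.
- split=> //; exists 0 => //; rewrite dstrip0; case: (rel_pred I x) => // y.
  by exists 0; rewrite mul0r addr0.
- move=> r1 r2 [h1 c1 [t1 T1 e1]] [h2 c2 [t2 T2 e2]]; split; first exact: TD.
    by rewrite chiD c1 c2 addr0.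
  exists (t1 + t2); first exact: TD.
  rewrite dstripD; case: (rel_pred I x) e1 e2 => [y [d1 ->] [d2 ->]|-> -> //].
  by exists (d1 + d2); rewrite mulrDl addrACA.
- move=> a b r1 [h1 c1 [t1 T1 e1]]; split; first exact: TM.
    by rewrite !chiM c1 mulr0 mul0r.
  (* Of the three terms of [dstrip] on [a * r1 * b], the one stripping [a] vanishes as
     [chi v r1 = 0], and the one stripping [b] stays in the ideal because [r1] does. *)
  exists (a * r1 * dstrip v x b + scal (chi v b) * a * t1).
    by apply: TD; [|rewrite -[_ * t1]mulr1]; exact: TM.
  rewrite dstrip_mul [dstrip v x (a * r1)]dstrip_mul c1 scal0 mul0r addr0 mulrA.
  case: (rel_pred I x) e1 => [y [d ->]|-> //].
  by exists (scal (chi v b) * a * d); rewrite mulrDr addrA !mulrA.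
move=> _ [y [z [yz ->]]]; split.
- by apply: (proj2 (R_gen _)); apply: ideal_gen_sub; exists y, z.
- by rewrite chiM chi_bigarr mul0r.
exists 0 => //; rewrite dstrip_mul chi_bigarr scal0 mul0r addr0 dstrip_bigarr //.
case: eqP => [e|_]; last first.
  by rewrite mulr0; case: (rel_pred I x) => // w; exists 0; rewrite mul0r addr0.
subst z; rewrite (rel_pred_eq yz) bigarr_tgt //.
by exists 1; rewrite mul1r add0r.
Qed.

(** Membership in the left ideal generated by the words of length [k], unfolded one rightmost arrow
    at a time. *)
Fixpoint span (k : nat) (f : P) : Prop :=
  if k is k'.+1 then
    exists2 c : A -> P, forall a, span k' (c a) & f = \sum_a c a * ar a
  else True.

(** Each factor without augmentation yields at least one arrow. The trailing [h] absorbs what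
    remains of a factor after its rightmost arrow is stripped. *)
Lemma span_prod (s : seq P) : (forall f, f \in s -> forall v, chi v f = 0) ->
  forall h, span (size s) ((\prod_(f <- s) f) * h).
Proof.
elim/last_ind: s => [|s f IH] sP h //; rewrite size_rcons /=.
exists (fun a => (\prod_(f <- s) f) * strip a (f * h)).
  by move=> a; apply: IH => f' sf'; apply: sP; rewrite mem_rcons inE sf' orbT.
rewrite -cats1 big_cat big_seq1 -mulrA {1}[f * h]decomp [X in _ * (X + _)]big1 => [|v _].
  by rewrite add0r mulr_sumr; apply: eq_bigr => a _; rewrite mulrA.
by rewrite chiM sP ?mul0r ?scal0 ?mul0r // mem_rcons mem_head.
Qed.

(** [u] accumulates the arrows already peeled off. *)
Lemma span_nil k f u : span k f ->
  (forall w, size w = k -> ideal_gen R ((\prod_(a <- w) ar a) * u)) ->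
  ideal_gen R (f * u).
Proof.
have [T0 TD TM] := ideal_genP R.
elim: k f u => [|k IH] f u /=.
  move=> _ /(_ [::] erefl); rewrite big_nil mul1r => hu.
  by rewrite -[f * u]mulr1; apply: TM.
move=> [c cP ->] hu; rewrite mulr_suml; apply: big_ind => // a _.
rewrite -mulrA; apply: IH => // w wk.
have := hu (rcons w a); rewrite size_rcons wk => /(_ erefl).
by rewrite -cats1 big_cat big_seq1 mulrA.
Qed.

Local Notation B := (quot_ring R).
Local Notation pi := (@qpi P R).

(** The image of the arrow ideal, described by vanishing augmentations; [R_nil] makes it
    nilpotent. *)
Definition rad (b : B) : Prop := exists2 f, b = pi f & forall v, chi v f = 0.

Lemma ideal_gen_chi r v : ideal_gen R r -> chi v r = 0.
Proof.
move=> /(proj1 (R_gen r)) /(_ (fun r => chi v r = 0)); apply; first split=> [|f h|f h r' r0] //.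
- by move=> f0 h0; rewrite chiD f0 h0 addr0.
- by rewrite !chiM r0 mulr0 mul0r.
by move=> _ [x [y [_ ->]]]; rewrite chiM chi_bigarr mul0r.
Qed.

Theorem labelled_criterion :
  gldim_finite B <-> forall x, exists k, iter k (obind (rel_pred I)) (Some x) = None.
Proof.
apply: (@gldim_finite_criterion B X V (fun x => pi (bigarr x)) (fun x => pi (bigtgt x))
  (fun v => pi (E v)) inS (rel_pred I) rad).
- split.
  + by exists 0; rewrite ?qpi0.
  + move=> _ _ [f -> f0] [h -> h0]; exists (f + h); first by rewrite qpiD.
    by move=> v; rewrite chiD f0 h0 addr0.
  + move=> a b _ [f -> f0]; have [a' ->] := qpi_surj a; have [b' ->] := qpi_surj b.
    exists (a' * f * b'); first by rewrite !qpiM.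
    by move=> v; rewrite !chiM f0 mulr0 mul0r.
- have [m mP] := R_nil; exists m => s sm sJ.
  (* The default representative 0 serves elements outside [rad], and none of these occurs in [s]. *)
  have pre b : exists f, rad b -> b = pi f /\ forall v, chi v f = 0.
    have [[f bf f0]|nb] := pselect (rad b); first by exists f.
    by exists 0.
  have [F FP] := choice pre.
  have -> : \prod_(b <- s) b = pi (\prod_(f <- map F s) f).
    rewrite qpi_prod big_map big_seq [RHS]big_seq.
    by apply: eq_bigr => b /sJ /FP [].
  apply/qpi_eq0; rewrite -[X in ideal_gen R X]mulr1.
  apply: (@span_nil m); last by move=> w wm; rewrite mulr1; apply: mP.
  rewrite -sm -(size_map F) -[X in span _ X]mulr1; apply: span_prod.
  by move=> _ /mapP [b /sJ /FP [_ f0] ->].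
- by move=> x; exists (bigarr x) => // v; exact: chi_bigarr.
- move=> x [f /qpiB_eq0 h f0]; have [w xw] := inT_ex x.
  have := ideal_gen_chi w h; have := chiD w (bigtgt x - f) f.
  by rewrite subrK chi_bigtgt // f0 addr0 => <- /eqP; rewrite oner_eq0.
- by move=> x; rewrite -qpiM bigtgt_idem.
- by move=> x; rewrite -qpiM bigtgt_arr.
- move=> x y /rel_predP xy; rewrite -!qpiM bigarr_tgt //; split=> //.
  by apply/qpi_eq0; apply: (proj2 (R_gen _)); apply: ideal_gen_sub; exists y, x.
- exact: inS_ex.
- by move=> x v xv; rewrite -qpiM bigarr_E0 // qpi0.
- by rewrite -qpi_sum E_sum.
- by move=> v; rewrite -qpiM E_mul eqxx.
- move=> v b bE; have [f fE] := qpi_surj b.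
  have {}fE : b = pi (f * E v) by rewrite qpiM -fE bE.
  have fw w : chi w (f * E v) = chi v f * (v == w)%:R.
    by rewrite chiM chi_E eq_sym; case: eqP => [->|]; rewrite ?mulr0.
  have [fv|fv] := eqVneq (chi v f) 0.
    by left; exists (f * E v) => // w; rewrite fw fv mul0r.
  (* Up to elements with zero augmentation, [f * E v] is [chi v f] times [E v]. *)
  right; exists (pi (scal (chi v f)^-1)); rewrite fE -qpiM -qpiN -qpiD; eexists; first by [].
  by move=> w; rewrite chiD chiN chi_scal fw chi_E eq_sym mulrA mulVf // mul1r subrr.
- move=> v b [f bf f0] bE.
  (* [E (tgt a) * bigarr x * E v] is [lam v] times the arrow [a], and [lam v] squares to 1, so these
     coefficients rebuild [f * E v] from its rightmost arrows. *)
  exists (fun x => pi (\sum_(a | (lab a == x) && (src a == v))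
    strip a f * scal (lam v) * E (tgt a))).
  have {bf}-> : b = pi (\sum_(a | src a == v) strip a f * ar a).
    rewrite -bE bf -qpiM; congr pi.
    rewrite {1}[f]decomp big1 ?add0r => [|w _]; last by rewrite f0 scal0 mul0r.
    rewrite mulr_suml [RHS]big_mkcond; apply: eq_bigr => a _.
    by rewrite -mulrA ar_E; case: eqP; rewrite ?mulr0.
  rewrite (partition_big lab predT) //= qpi_sum; apply: eq_bigr => x _.
  rewrite -[pi _ * pi (bigarr x)]qpiM -[_ * pi (E v)]qpiM; congr pi.
  rewrite !mulr_suml.
  apply: eq_big => [a|a /andP[/eqP av /eqP ax]]; first by rewrite andbC.
  rewrite -!mulrA [E _ * _]mulrA -ax -av E_bigarr_E [scal _ * (scal _ * _)]mulrA.
  by rewrite -scalM lam_sq scal1 mul1r.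
- move=> v c c0 x xv; have [C CE] := choice (fun x => qpi_surj (c x)).
  have /ideal_gen_mem /(_ v x xv) [_] : ideal_gen R (\sum_x C x * bigarr x * E v).
    apply/qpi_eq0; rewrite qpi_sum -[RHS]c0; apply: eq_bigr => y _.
    by rewrite !qpiM CE.
  (* Stripping isolates the coefficient of label [x], which [ideal_gen_mem] then places in the ideal
     plus the multiples of the next [bigarr]. *)
  have -> : dstrip v x (\sum_y C y * bigarr y * E v) = C x * bigtgt x.
    rewrite (big_morph _ (dstripD v x) (dstrip0 v x)).
    transitivity (\sum_y if y == x then C y * bigtgt x else 0); last first.
      exact: (sum_if_eq x predT).
    apply: eq_bigr => y _; rewrite dstrip_mul dstrip_E mulr0 add0r chi_E eqxx.
    rewrite scal1 mul1r dstrip_mul chi_bigarr scal0 mul0r addr0 dstrip_bigarr //.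
    by rewrite eq_sym; case: eqP; rewrite ?mulr0.
  rewrite /in_syz CE -qpiM; case: (rel_pred I x) => [y|] [t /qpi_eq0 t0].
    by move=> [d ->]; exists (pi d); rewrite qpiD t0 add0r qpiM.
  by move=> ->.
Qed.

End Generated.

(** * Comparison with relations given between fixed end vertices *)

Definition arr_at x u w : P := \sum_(a | [&& lab a == x, src a == u & tgt a == w]) ar a.

Definition quad x y u w : P :=
  \sum_(b | inS x b) scal (lam b) * (arr_at x b w * arr_at y u b).

Lemma E_bigarr x w : E w * bigarr x = \sum_(u | inS x u) scal (lam u) * arr_at x u w.
Proof.
transitivity (\sum_(a | (lab a == x) && (tgt a == w)) scal (lam (src a)) * ar a).
  rewrite mulr_sumr big_mkcondr; apply: eq_bigr => a _.
  by rewrite mulrA -scal_comm -mulrA E_ar; case: eqP; rewrite ?mulr0.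
rewrite (partition_big src (inS x)) => [|a /andP[/eqP <- _]]; last exact: lab_src.
apply: eq_bigr => u _; rewrite mulr_sumr; apply: eq_big => [a|a /andP[_ /eqP -> //]].
by rewrite -andbA; congr (_ && _); rewrite andbC.
Qed.

Lemma bigarr_E_at y u : bigarr y * E u = \sum_(w | inT y w) scal (lam u) * arr_at y u w.
Proof.
rewrite bigarr_E (partition_big tgt (inT y)) => [|a /andP[/eqP <- _]]; last exact: lab_tgt.
apply: eq_bigr => w _; rewrite mulr_sumr; apply: eq_bigl => a.
by rewrite andbA.
Qed.

Lemma arr_atM x b b' w y u : arr_at x b w * arr_at y u b' =
  if b' == b then arr_at x b w * arr_at y u b' else 0.
Proof.
have -> : arr_at x b w = arr_at x b w * E b.
  rewrite mulr_suml; apply: eq_bigr => a /and3P[_ /eqP ab _].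
  by rewrite ar_E ab eqxx.
case: eqP => // bb'; rewrite -mulrA [E b * _]mulr_sumr big1 ?mulr0 // => a.
by move=> /and3P[_ _ /eqP ab']; rewrite E_ar ab'; case: eqP.
Qed.

Lemma quad_bigarr x y u w : (x, y) \in I ->
  E w * (bigarr x * bigarr y) * E u = scal (lam u) * quad x y u w.
Proof.
move=> xy; rewrite mulrA -mulrA E_bigarr bigarr_E_at mulr_suml [RHS]mulr_sumr.
apply: eq_bigr => b xb; rewrite -mulrA mulr_sumr.
transitivity (scal (lam b) * \sum_(i | inT y i)
    if i == b then scal (lam u) * (arr_at x b w * arr_at y u i) else 0).
  congr (_ * _); apply: eq_bigr => i _.
  rewrite mulrA -[_ * scal _]scal_comm -mulrA arr_atM.
  by case: eqP; rewrite ?mulr0.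
rewrite sum_if_eq -(I_comp xy) [inS x b]xb [LHS]mulrA [RHS]mulrA -!scalM.
by rewrite [lam u * _]mulrC.
Qed.

Lemma arr_atE a : arr_at (lab a) (src a) (tgt a) = ar a.
Proof.
rewrite /arr_at (big_pred1 a) // => b; apply/idP/eqP => [/and3P[]|->]; last by rewrite !eqxx.
by move=> /eqP ? /eqP ? /eqP ?; apply: lab_inj.
Qed.

(** With a single possible middle vertex the relation has one term, so it is a monomial up to
    sign. *)
Lemma quad_monomial a b : (lab a, lab b) \in I -> src a = tgt b ->
  (forall v, inS (lab a) v -> v = src a) ->
  ar a * ar b = scal (lam (src a)) * quad (lab a) (lab b) (src b) (tgt a).
Proof.
move=> abI ab single; rewrite /quad (big_pred1 (src a)) => [|v].
  rewrite arr_atE [in arr_at _ _ (src a)]ab arr_atE mulrA -scalM lam_sq scal1.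
  by rewrite mul1r.
by apply/idP/eqP => [/single|->]; last exact: lab_src.
Qed.

(** Up to a sign, each [quad] is a component [E w * _ * E u] of a product of two [bigarr];
    conversely that product is the sum of its components. *)
Lemma quad_gen : (forall z, R z <->
    exists x y u w, [/\ (x, y) \in I, inS y u, inT x w & z = quad x y u w]) ->
  forall z, ideal_gen R z <-> ideal_gen bigrels z.
Proof.
move=> RP z; split=> hz; apply: hz; try exact: ideal_genP.
  move=> _ /RP [x [y [u [w [xy yu xw ->]]]]].
  have [_ _ TM] := ideal_genP bigrels.
  have -> : quad x y u w = scal (lam u) * E w * (bigarr x * bigarr y) * E u.
    by rewrite -[LHS]mul1r -scal1 -(lam_sq u) scalM -mulrA -quad_bigarr // !mulrA.
  by apply: TM; apply: ideal_gen_sub; exists x, y.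
move=> _ [x [y [xy ->]]].
have [T0 TD TM] := ideal_genP R.
have -> : bigarr x * bigarr y = \sum_w \sum_u E w * (bigarr x * bigarr y) * E u.
  rewrite -{1}[_ * _]mul1r -E_sum mulr_suml; apply: eq_bigr => w _.
  by rewrite -mulr_sumr E_sum mulr1.
apply: big_ind => // w _; apply: big_ind => // u _.
have [xw|xw] := boolP (inT x w); last first.
  have -> : E w * (bigarr x * bigarr y) = 0; last by rewrite mul0r.
  rewrite mulrA [E w * bigarr x]mulr_sumr big1 ?mul0r // => a /eqP ax.
  rewrite mulrA -scal_comm -mulrA E_ar; case: eqP => [aw|_]; last by rewrite mulr0.
  by rewrite -aw -ax lab_tgt in xw.
have [yu|yu] := boolP (inS y u); last first.
  by rewrite -!mulrA bigarr_E0 // !mulr0.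
rewrite quad_bigarr // -[_ * quad _ _ _ _]mulr1; apply: TM.
by apply: ideal_gen_sub; apply/RP; exists x, y, u, w.
Qed.

End Labelled.
End StripRing.

(** Scalars become central ring elements, so that the abstract calculus needs no module
    structure. *)
Definition pa_scal (K : fieldType) (Q : quiver) (c : K) : path_alg K Q := c *: pa_one K Q.

Lemma pa_scalE (K : fieldType) (Q : quiver) (c : K) (f : path_alg K Q) :
  pa_scal Q c * f = c *: f.
Proof. by rewrite /pa_scal pa_scalerAl [_ * f]mul1r. Qed.

Lemma path_alg_strip_ring (K : fieldType) (Q : quiver) :
  strip_ring (@src Q) (@tgt Q) (@pa_vert K Q) (@pa_arr K Q) (@pa_scal K Q)
    (@chi K Q) (@strip K Q).
Proof.
split.
- by move=> c f; rewrite pa_scalE /pa_scal pa_scalerAr mulr1.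
- by move=> c d; rewrite pa_scalE /pa_scal scalerA.
- exact: scale0r.
- exact: scale1r.
- exact: chi0.
- exact: chiD.
- exact: chiM.
- by move=> v c f; rewrite pa_scalE chiZ.
- exact: chi_vert.
- exact: chi_arr.
- exact: strip0.
- exact: stripD.
- by move=> a c f; rewrite !pa_scalE stripZ.
- by move=> a f h; rewrite pa_scalE strip_mul.
- exact: strip_vert.
- exact: strip_arr.
- move=> f; rewrite {1}[f]pa_decomp; congr (_ + _).
  by apply: eq_bigr => v _; rewrite pa_scalE.
- exact: pa_vertM.
- exact: pa_vert_sum.
- exact: pa_arr_vert.
- exact: pa_vert_arr.
Qed.

(** A word of length [m] has two neighbours failing [ok], and their product already lies in the
    ideal. *)
Lemma words_nilpotent (P : pzRingType) (A : Type) (ar : A -> P) (R : P -> Prop) (ok : rel A) :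
  (forall a b, ~~ ok a b -> ideal_gen R (ar a * ar b)) ->
  (exists m, forall w, size w = m -> ~~ sorted ok w) ->
  exists m, forall w, size w = m -> ideal_gen R (\prod_(a <- w) ar a).
Proof.
have [_ _ TM] := ideal_genP R.
move=> okR [m mP]; exists m => w /mP; elim: w => // a [|b w] // IH /=.
rewrite negb_and => /orP[/okR h|/IH h]; rewrite big_cons.
  by rewrite big_cons mulrA -[ar a * _]mul1r; apply: TM.
by rewrite -[ar a * _]mulr1; apply: TM.
Qed.

(** * Monomial relations: every arrow is its own label *)

Section MonomialAlgebra.
Variables (K : fieldType) (Q : quiver) (I : {set arr Q * arr Q}).
Hypothesis I_comp : forall a b, (a, b) \in I -> tgt b = src a.
Hypothesis I_uniq : forall a a' b, (a, b) \in I -> (a', b) \in I -> a = a'.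
Hypothesis I_words : exists m, forall w, size w = m ->
  ~~ sorted (free_rel (@src Q) (@tgt Q) I) w.

Lemma monomial_criterion : gldim_finite (quot_ring (pa_rels (K := K) I)) <->
  forall a, exists k, iter k (obind (rel_pred I)) (Some a) = None.
Proof.
have L := path_alg_strip_ring K Q.
apply: (@labelled_criterion K _ _ _ _ _ _ _ _ _ _ L (arr Q) id
  (fun a v => src a == v) (fun a v => tgt a == v) (fun=> 1)).
- by move=> v; rewrite mul1r.
- by move=> a; exact: eqxx.
- by move=> a; exact: eqxx.
- by move=> a u w /eqP <- /eqP <-; exists a.
- by [].
- by move=> a; exists (src a).
- by move=> a; exists (tgt a).
- by move=> a b /I_comp ba v; rewrite ba.
- exact: I_uniq.
- have bE a : bigarr (@src Q) (@pa_arr K Q) (@pa_scal K Q) id (fun=> 1) a = pa_arr K a.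
    by rewrite /bigarr (big_pred1 a) // pa_scalE scale1r.
  move=> z; split=> hz; apply: hz; try exact: ideal_genP.
    move=> _ [[a b] ab ->]; apply: ideal_gen_sub; exists a, b; split; first exact: ab.
    exact: (congr2 *%R (esym (bE a)) (esym (bE b))).
  move=> _ [a [b [ab ->]]]; apply: ideal_gen_sub; exists (a, b); first exact: ab.
  exact: (congr2 *%R (bE a) (bE b)).
- apply: words_nilpotent I_words => a b; rewrite negb_and negbK => /orP[ab|ab].
    by rewrite (ar_mul0 L) //; have [] := ideal_genP (pa_rels (K := K) I).
  by apply: ideal_gen_sub; exists (a, b).
Qed.

End MonomialAlgebra.

(** * The algebras of a skewed-gentle triple *)

Section SkewedGentleTriple.
Variables (K : fieldType) (Q : quiver) (Sp : {set vert Q}) (I : {set arr Q * arr Q}).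

(** A relation at a special vertex becomes a sum of two terms in the skewed-gentle algebra and kills
    no single path of length 2, so only relations at ordinary vertices are excluded. *)
Definition ord_rel (a b : arr Q) : bool :=
  (src a == tgt b) && ~~ (((a, b) \in I) && (src a \notin Sp)).

Local Notation Qsp := (quiver_sp Sp).
Local Notation Isp := (rels_sp Sp I).

(* Padding with loops is what lets admissibility of <I^sp> bound words that pass
   through special vertices. *)
Fixpoint with_loops (w : seq (arr Q)) : seq (arr Qsp) :=
  if w is a :: w' then
    inl a :: (if insub (src a) is Some v then inr v :: with_loops w' else with_loops w')
  else [::].

Lemma size_with_loops w : (size w <= size (with_loops w))%N.
Proof.
elim: w => //= a w IH; rewrite ltnS; case: insubP => [v _ _|_] //=.
exact: leq_trans IH (leqnSn _).
Qed.

(** A relation at a special vertex is interrupted by the inserted loop, and [rels_sp] contains no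
    pair mixing a loop with an arrow of [Q]. *)
Lemma with_loops_free w : sorted ord_rel w ->
  sorted (free_rel (@src Qsp) (@tgt Qsp) Isp) (with_loops w).
Proof.
case: w => // a w /=; elim: w a => [|b w IH] a /=.
  case: insubP => [v _ va|_] // _; rewrite /= /free_rel inE /= andbT.
  by rewrite -va andbT; exact: eqxx.
move=> /andP[/andP[/eqP ab abI] /IH hw].
case: insubP => [v vSp va|aSp] /=.
  by rewrite hw andbT /free_rel !inE /= -va -ab -va !eqxx.
by rewrite /free_rel /= ab eqxx inE /=; move: abI; rewrite aSp andbT => ->.
Qed.

Hypothesis sg : skewed_gentle K Sp I.

(** An allowed word of length [m], padded and cut back to length [m], is a nonempty free word in the
    [m]-th power of the arrow ideal. Admissibility would put it in the ideal of relations, against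
    [free_word_notin]. *)
Lemma ord_words : exists m, forall w, size w = m -> ~~ sorted ord_rel w.
Proof.
have [_ [_ [_ [m m2 mP]] _ _ _]] := sg; exists m => w wm; apply/negP => sw.
pose u := take m (with_loops w).
have um : size u = m.
  by rewrite size_take_min; apply/minn_idPl; rewrite -wm; exact: size_with_loops.
have su : sorted (free_rel (@src Qsp) (@tgt Qsp) Isp) u.
  by apply: take_sorted; exact: with_loops_free.
have u0 : u != [::] by rewrite -size_eq0 um; case: (m) m2.
apply: (free_word_notin (path_alg_strip_ring K Qsp) (S := pa_rels Isp) _ su u0).
  by move=> _ [[a b] ab ->]; exists a, b.
apply: mP; apply: ideal_gen_sub.
case: u um {su} u0 => [|x0 u] // um _.
exists (fun i : 'I_m => pa_arr K (nth x0 (x0 :: u) i)); split.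
  by move=> i; apply: ideal_gen_sub; eexists.
by rewrite (big_nth x0) um big_mkord.
Qed.

Lemma sg_comp a b : (a, b) \in I -> tgt b = src a.
Proof. by case: sg => -[+ _ _ _ _] _; apply. Qed.

Lemma sg_uniq a a' b : (a, b) \in I -> (a', b) \in I -> a = a'.
Proof.
case: sg => -[_ _ _ _ hI] _ ab a'b; have [_ /card_le1_eqP h] := hI b.
by apply: h; rewrite inE ?ab ?a'b andbT eq_sym; apply/eqP/sg_comp.
Qed.

Lemma gentle_criterion : gldim_finite (quot_ring (pa_rels (K := K) I)) <->
  forall a, exists k, iter k (obind (rel_pred I)) (Some a) = None.
Proof.
apply: monomial_criterion; [exact: sg_comp|exact: sg_uniq|].
have [m mP] := ord_words; exists m => w /mP; apply: contra.
apply: sub_sorted => a b /andP[ab abI]; rewrite /ord_rel ab.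
by rewrite (negPf abI).
Qed.

(** * The associated gentle pair *)

Lemma rels_g_fst (p q : arr (quiver_g Sp)) : (p, q) \in rels_g Sp I -> (p.1, q.1) \in I.
Proof. by rewrite inE => /andP[]. Qed.

Lemma split_at_eq (V : finType) (S : {set V}) v w e e' :
  split_at S v e = split_at S w e' -> v = w /\ (v \in S -> e = e').
Proof.
move=> /(congr1 val) [] -> h; split=> // wS.
by move: h; rewrite wS => -[].
Qed.

Lemma split_at_notin (V : finType) (S : {set V}) v e e' :
  v \notin S -> split_at S v e = split_at S v e'.
Proof. by move=> vS; apply: val_inj; rewrite /= (negPf vS). Qed.

Lemma split_vert_inj (V : finType) (S : {set V}) (u v : split_vert S) :
  base u = base v -> base u \notin S -> u = v.
Proof.
move=> uv uS; apply: val_inj; rewrite [LHS]surjective_pairing [RHS]surjective_pairing.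
congr pair => //; have /eqP := valP u; have /eqP := valP v.
rewrite -[(val v).1]/(base v) -[(val u).1]/(base u) -uv (negPf uS).
by case: (val u).2; case: (val v).2.
Qed.

Lemma associated_criterion : gldim_finite (quot_ring (pa_rels (K := K) (rels_g Sp I))) <->
  forall a, exists k, iter k (obind (rel_pred (rels_g Sp I))) (Some a) = None.
Proof.
apply: monomial_criterion.
- move=> [a e] [b e']; rewrite inE /= => /andP[ab].
  rewrite (sg_comp ab); case: ifP => [bS _|bS /eqP -> //].
  by apply: split_at_notin; rewrite inE bS.
- move=> [a e] [a' e'] [b e'']; rewrite !inE /= => /andP[ab h] /andP[a'b h'].
  rewrite (sg_uniq ab a'b); congr pair; move: h h'.
  by case: (_ \in Sp); case: e; case: e'; case: e''.
(* Forgetting signs turns free words into allowed ones: at an ordinary vertex composable arrows have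
   equal signs, so a relation of [I] there would lift to one of [rels_g]. *)
- have [m mP] := ord_words; exists m => w wm.
  have := mP (map fst w); rewrite size_map => /(_ wm); apply: contra.
  rewrite sorted_map; apply: sub_sorted => -[a e] [b e'] /andP[/= /eqP ab].
  have [ab' ee'] := split_at_eq ab; rewrite !inE /= /ord_rel ab' eqxx /=.
  apply: contra => /andP[-> bS]; rewrite (negPf bS) /=.
  by apply/eqP/ee'; rewrite inE ab'.
Qed.

(** Every relation lifts to signed arrows, with the sign kept at an ordinary vertex and flipped at a
    special one. *)
Lemma rel_pred_g (a : arr (quiver_g Sp)) :
  omap fst (rel_pred (rels_g Sp I) a) = rel_pred I a.1.
Proof.
rewrite {1}/rel_pred; case: pickP => [b /rels_g_fst ba|none] /=.
  by rewrite (rel_pred_eq sg_uniq ba).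
rewrite /rel_pred; case: pickP => // c ca; case: a none ca => a e none /= ca.
have := none (c, if tgt a \in Sp then ~~ e else e); rewrite inE /= ca /=.
by case: ifP => ->; rewrite ?eqxx //; case: (e).
Qed.

Lemma rel_pred_nil_g :
  (forall a, exists k, iter k (obind (rel_pred (rels_g Sp I))) (Some a) = None) <->
  (forall a, exists k, iter k (obind (rel_pred I)) (Some a) = None).
Proof.
have iterE k (a : arr (quiver_g Sp)) :
    omap fst (iter k (obind (rel_pred (rels_g Sp I))) (Some a)) =
    iter k (obind (rel_pred I)) (Some a.1).
  by elim: k => //= k <-; case: (iter k _ _) => //= b; exact: rel_pred_g.
split=> h a.
  by have [k ka] := h (a, true); exists k; rewrite -(iterE k (a, true)) ka.
by have [k ka] := h a.1; exists k; move: (iterE k a); rewrite ka; case: (iter k _ _).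
Qed.

(** * The skewed-gentle algebra *)

Local Notation Qsg := (quiver_sg Sp).
Local Notation vsg := (split_vert Sp).

Definition lab_sg (t : arr Qsg) : arr Q := (val t).1.2.

Lemma pa_arr_sgE u x w : base u = src x -> base w = tgt x ->
  pa_arr_sg K u x w = arr_at (@src Qsg) (@tgt Qsg) (@pa_arr K Qsg) lab_sg x u w.
Proof.
move=> ux wx; rewrite /pa_arr_sg; case: insubP => [t _ vt|]; last first.
  by rewrite /= ux wx !eqxx.
rewrite /arr_at (big_pred1 t) //= => s; rewrite /lab_sg /=.
apply/idP/eqP => [/and3P[/eqP sx /eqP su /eqP sw]|->].
  apply: val_inj; rewrite vt; case: s sx su sw => -[[s1 s2] s3] hs /= sx su sw.
  by rewrite sx su sw.
by rewrite vt !eqxx.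
Qed.

Lemma skewed_criterion : gldim_finite (quot_ring (rels_sg (K := K) (Sp := Sp) I)) <->
  forall a, exists k, iter k (obind (rel_pred I)) (Some a) = None.
Proof.
have L := path_alg_strip_ring K Qsg.
pose inS (x : arr Q) (u : vsg) := base u == src x.
pose inT (x : arr Q) (u : vsg) := base u == tgt x.
have lam_sq (v : vsg) : sg_sign K v * sg_sign K v = 1.
  by rewrite /sg_sign; case: ifP; rewrite ?mulrNN mulr1.
have lab_src (t : arr Qsg) : inS (lab_sg t) (src t).
  by have /andP[] := valP t.
have lab_tgt (t : arr Qsg) : inT (lab_sg t) (tgt t).
  by have /andP[] := valP t.
have lab_inj (s t : arr Qsg) : lab_sg s = lab_sg t -> src s = src t -> tgt s = tgt t -> s = t.
  case: s t => [[[s1 s2] s3] hs] [[[t1 t2] t3] ht]; rewrite /lab_sg /= => e1 e2 e3.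
  by apply: val_inj; rewrite /= e1 e2 e3.
have I_comp x y : (x, y) \in I -> inS x =1 inT y.
  by move=> /sg_comp xy v; rewrite /inS /inT xy.
have base_ex (v : vert Q) : exists u : vsg, base u = v by exists (split_at Sp v true).
(* The triples occurring in these relations are all arrows, so [pa_arr_sg] never takes its default
   value here and agrees with [arr_at]. *)
have RP z : rels_sg I z <-> exists x y u w, [/\ (x, y) \in I, inS y u, inT x w &
    z = quad (@src Qsg) (@tgt Qsg) (@pa_arr K Qsg) (@pa_scal K Qsg) lab_sg inS
      (@sg_sign K Q Sp) x y u w].
  split=> [[x [y [u [w [xy uy wx ->]]]]]|[x [y [u [w [xy /eqP uy /eqP wx ->]]]]]];
    exists x, y, u, w; split=> //; try exact/eqP.
    apply: eq_bigr => b /eqP bx; rewrite pa_scalE !pa_arr_sgE //.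
    by rewrite (sg_comp xy).
  apply: eq_bigr => b /eqP bx; rewrite pa_scalE !pa_arr_sgE //.
  by rewrite (sg_comp xy).
apply: (@labelled_criterion K _ _ _ _ _ _ _ _ _ _ L (arr Q) lab_sg inS inT (@sg_sign K Q Sp)) => //.
- move=> x u w xu xw.
  have h : (base u == src x) && (base w == tgt x) by apply/andP.
  by exists (exist _ (u, x, w) h).
- by move=> x; have [u ux] := base_ex (src x); exists u; apply/eqP.
- by move=> x; have [u ux] := base_ex (tgt x); exists u; apply/eqP.
- exact: sg_uniq.
- exact: (quad_gen L lam_sq lab_src lab_tgt I_comp RP).
(* A pair failing this test either does not compose or is a relation at an ordinary vertex. *)
pose ok (s t : arr Qsg) := (src s == tgt t) && ord_rel (lab_sg s) (lab_sg t).
apply: (words_nilpotent (ok := ok)); last first.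
  have [m mP] := ord_words; exists m => w wm.
  have := mP (map lab_sg w); rewrite size_map => /(_ wm); apply: contra.
  by rewrite sorted_map; apply: sub_sorted => s t /andP[].
have [T0 _ TM] := ideal_genP (rels_sg (K := K) (Sp := Sp) I).
move=> s t; rewrite negb_and; case: eqP => [st|/eqP st _]; last first.
  by rewrite (ar_mul0 L).
rewrite /ord_rel; have st' : src (lab_sg s) = tgt (lab_sg t).
  by have /eqP <- := lab_src s; have /eqP <- := lab_tgt t; rewrite st.
rewrite st' eqxx negbK /= -st' => /andP[stI ordS].
(* An ordinary vertex is not split, so the relation through it has a single term. *)
have single v : inS (lab_sg s) v -> v = src s.
  move=> /eqP vs; have /eqP ss := lab_src s.
  by apply: split_vert_inj; rewrite vs ?ss.
rewrite (quad_monomial L lam_sq lab_src lab_inj stI st single).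
rewrite -[_ * quad _ _ _ _ _ _ _ _ _ _ _]mulr1; apply: TM.
apply: ideal_gen_sub; apply/RP; exists (lab_sg s), (lab_sg t), (src t), (tgt s).
by split.
Qed.

End SkewedGentleTriple.

Theorem corollary4p5 (K : closedFieldType) (Q : quiver)
    (Sp : {set vert Q}) (I : {set arr Q * arr Q})
    (QSpI_skewed_gentle : skewed_gentle K Sp I) :
  (gldim_finite (quot_ring (rels_sg (K := K) (Sp := Sp) I)) <->
   gldim_finite (quot_ring (pa_rels (K := K) I))) /\
  (gldim_finite (quot_ring (pa_rels (K := K) I)) <->
   gldim_finite (quot_ring (pa_rels (K := K) (rels_g Sp I)))).
Proof.
rewrite (skewed_criterion QSpI_skewed_gentle) (gentle_criterion QSpI_skewed_gentle).
by rewrite (associated_criterion QSpI_skewed_gentle) (rel_pred_nil_g QSpI_skewed_gentle).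
Qed.
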